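(* Let $f\in\mathcal{F}(\mathbb{R}^n)$ be such that $\Vert f\Vert_\infty=f(0)$ and let $h:L(f)\to[0,\infty)$ be a concave function, where $L(f)=\{(x,t)\in\mathbb{R}^n\times[0,\infty): f(x)\geq e^{-t}\Vert f\Vert_\infty\}$. Let $\nu$ be the measure on $\mathbb{R}^n\times[0,\infty)$ given by $d\nu(x,t)=dG_n(x)\otimes e^{-t}dt$. Then, for any $0<p\leq q$, $$ \left(\frac{1}{\Gamma(1+q)\,\nu(L(f))}\int_{L(f)}h^q(x,t)\,d\nu(x,t)\right)^{1/q}\leq\left(\frac{1}{\Gamma(1+p)\,\nu(L(f))}\int_{L(f)+C_n}(h\star\chi_{C_n})^p(x,t)\,d\nu(x,t)\right)^{1/p}. $$
   Context: A function $f:\mathbb{R}^n\to[0,\infty)$ is log-concave if $f=e^{-u}$ with $u:\mathbb{R}^n\to(-\infty,\infty]$ convex (with $e^{-\infty}=0$). $\mathcal{F}(\mathbb{R}^n)$ is the set of Lebesgue-integrable log-concave functions on $\mathbb{R}^n$ with positive integral; $\Vert f\Vert_\infty=\sup f$. $G_n$ is the lattice point enumerator measure, $G_n(A)=\#(A\cap\mathbb{Z}^n)$. Here $C_n$ denotes the set $(-1,1)^n\times\{0\}\subseteq\mathbb{R}^{n+1}$. The function $h\star\chi_{C_n}:L(f)+C_n\to[0,\infty)$ is $$(h\star\chi_{C_n})(x,t)=\sup\{h(x-v,t): v\in(-1,1)^n,\ (x-v,t)\in L(f)\},$$ i.e. the Asplund product $(g_1\star g_2)(w)=\sup_{z}g_1(z)g_2(w-z)$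 of the extension of $h$ by $0$ outside $L(f)$ and the characteristic function of $C_n$. *)

(* Defs.v *)
From HB Require Import structures.
From mathcomp Require Import all_boot all_order all_algebra.
From mathcomp Require Import all_classical all_reals all_analysis.

Set Implicit Arguments.
Unset Strict Implicit.
Unset Printing Implicit Defensive.

Import Order.TTheory GRing.Theory Num.Theory.
Import numFieldNormedType.Exports.

Local Open Scope classical_set_scope.
Local Open Scope ring_scope.

Section lebesgue_Rn.
Context {R : realType} {n : nat}.
Local Notation V := 'rV[R]_n.

(* I = (a, b) stands for the closed box [a_1, b_1] x ... x [a_n, b_n]. *)
Definition box (I : V * V) : set V :=
  [set x | forall i, x 0 i \in `[I.1 0 i, I.2 0 i]].

Definition box_volume (I : V * V) : \bar R :=
  (\prod_(i < n) Num.max 0 (I.2 0 i - I.1 0 i))%:E.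

(* Families of boxes may be finite, so that the empty set has outer measure 0
   also for n = 0, where every box has volume 1. *)
Definition lebesgue_outer (A : set V) : \bar R :=
  ereal_inf [set \esum_(I in F) box_volume I | F in
    [set F : set (V * V) | countable F /\ A `<=` \bigcup_(I in F) box I]].

Lemma box_volume_ge0 I : (0 <= box_volume I)%E.
Proof.
by rewrite lee_fin; apply: prodr_ge0 => i _; rewrite le_max lexx.
Qed.

Lemma lebesgue_outer0 : lebesgue_outer set0 = 0%E.
Proof.
apply/eqP; rewrite eq_le; apply/andP; split; last first.
  by apply: le_ereal_inf_tmp => _ [F _ <-]; apply: esum_ge0 => I _; exact: box_volume_ge0.
by apply: ereal_inf_lbound; exists set0; [split => //; exact: countable0|rewrite esum_set0].
Qed.

Lemma lebesgue_outer_ge0 A : (0 <= lebesgue_outer A)%E.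
Proof.
by apply: le_ereal_inf_tmp => _ [F _ <-]; apply: esum_ge0 => I _; exact: box_volume_ge0.
Qed.

Lemma le_lebesgue_outer :
  {homo lebesgue_outer : A B / A `<=` B >-> (A <= B)%E}.
Proof.
move=> A B AB; apply: ereal_inf_le_tmp => _ [F [cF BF] <-].
by exists F => //; split => //; exact: subset_trans BF.
Qed.

Lemma lebesgue_outer_sigma_subadditive : sigma_subadditive lebesgue_outer.
Proof.
move=> A; have [[i ioo]|] := pselect (exists i, lebesgue_outer (A i) = +oo%E).
  rewrite (eseries_pinfty _ _ ioo) ?leey// => k _.
  by rewrite -ltNye (lt_le_trans _ (lebesgue_outer_ge0 _)).
rewrite -forallNE => Aoo.
apply/lee_addgt0Pr => _/posnumP[e].
rewrite (le_trans _ (epsilon_trick _ _ _))//; last first.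
  by move=> k; exact: lebesgue_outer_ge0.
pose P k (F : set (V * V)) := [/\ countable F, A k `<=` \bigcup_(I in F) box I &
  (\esum_(I in F) box_volume I <=
   lebesgue_outer (A k) + (e%:num / (2 ^ k.+1)%:R)%:E)%E].
have [G PG] : {G : nat -> set (V * V) & forall k, P k (G k)}.
  apply: (@choice _ _ P) => k; rewrite /P /lebesgue_outer.
  set S := (X in ereal_inf X).
  have Sfin : ereal_inf S \is a fin_num.
    rewrite ge0_fin_numE; last exact: (lebesgue_outer_ge0 (A k)).
    by rewrite lt_neqAle leey andbT; apply/eqP; exact: Aoo.
  have en1 : 0 < e%:num / (2 ^ k.+1)%:R :> R by [].
  have [_ [F [cF AF] <-] Fe] := lb_ereal_inf_adherent en1 Sfin.
  by exists F; split => //; exact/ltW.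
apply: (@le_trans _ _ (\esum_(I in \bigcup_k G k) box_volume I)%E).
  apply: ereal_inf_lbound; exists (\bigcup_k G k) => //; split.
    by apply: bigcup_countable => // k _; have [] := PG k.
  move=> x [k _ Akx]; have [_ /(_ _ Akx)[I GI Ix] _] := PG k.
  by exists I => //; exists k.
rewrite seqDU_bigcup_eq esum_bigcupT; last 2 first.
  - exact: trivIset_seqDU.
  - exact: box_volume_ge0.
rewrite -nneseries_esumT; last first.
  by move=> k; apply: esum_ge0 => I _; exact: box_volume_ge0.
apply: lee_nneseries => k _.
  by move=> _; apply: esum_ge0 => I _; exact: box_volume_ge0.
have [_ _] := PG k; apply: le_trans.
rewrite esum_mkcond [leRHS]esum_mkcond; apply: le_esum => I _.
case: ifPn => [/set_mem/(@subset_seqDU _ G k)/mem_set ->|_] //.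
by case: ifPn => // _; exact: box_volume_ge0.
Qed.

HB.instance Definition _ := isOuterMeasure.Build R V lebesgue_outer
  lebesgue_outer0 lebesgue_outer_ge0 le_lebesgue_outer
  lebesgue_outer_sigma_subadditive.

End lebesgue_Rn.

Definition lebesgue_outer_measure (R : realType) (n : nat) :
    {outer_measure set 'rV[R]_n -> \bar R} :=
  @lebesgue_outer R n.

(* Being Caratheodory-measurable with respect to [lebesgue_outer] is being
   Lebesgue measurable: the sigma-algebra is complete, so that the log-concave
   functions that are not Borel are not excluded. *)
Definition lebesgueRn (R : realType) (n : nat) :
    {measure set (caratheodory_type (lebesgue_outer_measure R n)) -> \bar R} :=
  (lebesgue_outer_measure R n :
     set (caratheodory_type (lebesgue_outer_measure R n)) -> \bar R).

Section log_concave.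
Context {R : realType} {n : nat}.
Local Notation V := 'rV[R]_n.
Implicit Type f : V -> R.

(* In [\bar R], [0 * +oo = 0], so that t = 0 and t = 1 need no special case. *)
Definition convex_ereal (u : V -> \bar R) :=
  forall (x y : V) (t : R), 0 <= t <= 1 ->
    (u (t *: x + (1 - t) *: y)%R <= t%:E * u x + (1 - t)%:E * u y)%E.

Definition log_concave f :=
  exists u : V -> \bar R, [/\ forall x, u x != -oo%E, convex_ereal u &
    forall x, (f x)%:E = expeR (- u x)].

Definition integrable_log_concave f :=
  [/\ log_concave f,
      (@lebesgueRn R n).-integrable setT (EFin \o f) &
      (0 < \int[@lebesgueRn R n]_x (f x)%:E)%E].

Definition supnorm f : \bar R := ereal_sup (range (EFin \o f)).

Definition Lset f : set (V * R) :=
  [set z | 0 <= z.2 /\ ((expR (- z.2))%:E * supnorm f <= (f z.1)%:E)%E].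

End log_concave.

Definition concave_on (R : realType) (n : nat) (D : set ('rV[R]_n * R))
    (h : 'rV[R]_n * R -> R) :=
  @convex_function R ('rV[R]_n * R^o)%type D (fun z => - h z).

Definition minkowski_sum (V : zmodType) (A B : set V) : set V :=
  [set a + b | a in A & b in B].

Definition asplund (R : realType) (V : zmodType) (g1 g2 : V -> R) (w : V) :
    \bar R :=
  ereal_sup [set (g1 z * g2 (w - z))%:E | z in setT].

Definition cubeC (R : realType) (n : nat) : set ('rV[R]_n * R) :=
  [set w : 'rV[R]_n * R | (forall i, -1 < w.1 0 i < 1) /\ w.2 = 0].

Definition Gamma (R : realType) (s : R) : \bar R :=
  (\int[lebesgue_measure]_(t in `]0%R, +oo[)
     (t `^ (s - 1) * expR (- t))%R%:E)%E.

(* The lattice point enumerator is defined on all subsets of R^n, hence the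
   power set as sigma-algebra; the Borel one would be too small, since Lset f
   and the concave functions on it need not be Borel. *)
Definition discreteRn (R : realType) (n : nat) : Type := 'rV[R]_n.

HB.instance Definition _ (R : realType) (n : nat) :=
  Pointed.on (discreteRn R n).
HB.instance Definition _ (R : realType) (n : nat) :=
  @isMeasurable.Build default_measure_display (discreteRn R n)
    discrete_measurable discrete_measurable0 discrete_measurableC
    discrete_measurableU.

Definition Zn (R : realType) (n : nat) : set (discreteRn R n) :=
  [set x : 'rV[R]_n | forall i, x 0 i \is a Num.int].

Lemma measurable_Zn (R : realType) (n : nat) : measurable (@Zn R n).
Proof. by []. Qed.

Definition lattice_enum (R : realType) (n : nat) :
    {measure set (discreteRn R n) -> \bar R} :=
  mrestr counting (@measurable_Zn R n).

(* The density of [exponential_prob 1] is e^-t on [0, +oo[ and 0 elsewhere. *)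
Definition expdt (R : realType) : probability (measurableTypeR R) R :=
  exponential_distribution_exponential_prob__canonical__probability_measure_Probability
    (ltr01 : 0 < 1 :> R).

Definition nu (R : realType) (n : nat) :
    {measure set (discreteRn R n * measurableTypeR R) -> \bar R} :=
  (@lattice_enum R n \x @expdt R)%E.

(* Main.v *)
(* Let L = Lset f, phi(s) = nu {h > s} and psi(s) = nu {h * chi_C > s}.  Since L
   is upward closed in t, the concave function h >= 0 is nondecreasing in t, so
   that the superlevel sets are unions of vertical half-lines {x} x [tau(x), +oo[ and nu of such a set is the
   sum over the lattice points x of exp(- tau(x)).  A discrete
   Prekopa-Leindler inequality, obtained by tensorization from a discrete
   Brunn-Minkowski inequality on the line, then yields
     psi (l s) >= nu(L)^(1-l) phi(s)^l    for 0 < l < 1.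
   Hence, if phi(s) exceeds the exponential nu(L) exp(- c s) at some s, psi
   exceeds it on the whole interval ]0, s[.  So there is a threshold s0 such
   that psi >= nu(L) exp(- c s) before s0 and phi <= nu(L) exp(- c s) after s0.
   Choosing c so that the exponential and psi have (almost) equal p-th moments,
   the q-th moment of phi is at most that of the exponential. *)
Require Import Defs.
From HB Require Import structures.
From mathcomp Require Import all_boot all_order all_algebra.
From mathcomp Require Import all_classical all_reals all_analysis.
From mathcomp Require Import measurable_realfun.
From mathcomp Require Import ring lra.
Set Implicit Arguments.
Unset Strict Implicit.
Unset Printing Implicit Defensive.

Import Order.TTheory GRing.Theory Num.Theory.
Import numFieldNormedType.Exports.

Local Open Scope classical_set_scope.
Local Open Scope ring_scope.

(** * A discrete Brunn-Minkowski inequality on the line *)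

(** A convex combination of lattice points is rarely a lattice point. It is replaced by the lattice
    points at distance less than 1 in every coordinate, and this rounding is where the open cube on
    the right-hand side comes from. In the vertical direction nothing is lost: half-lines starting
    at t and u have masses exp(- t) and exp(- u), and the one starting at (1-l) t + l u has exactly
    their geometric mean as mass. The exponential is the equality case of the inequality between phi
    and psi: the mean of nu(L) and nu(L) exp(- c s) with weights 1-l and l is nu(L) exp(- c l s).
    Its moment of order p is nu(L) c^(-p) Gamma(1+p), whence the Gamma factors in the normalization.
    The moments are only almost equal, that of the exponential being strictly larger: equality would
    need an infinite c when the moment of psi vanishes, and strictness is what keeps the threshold
    s0 finite. *)

Section integer_neighbours.
Variable R : realType.
Implicit Types (x y c d : R) (N : seq int).

(* [c] is a lower bound for the length of the part lying left of [x] of the union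
   of the intervals [z, z + 1], z in N; its part right of [x] has length
   [ceil x + 1 - x]. *)
Definition covers N x c :=
  [/\ uniq N, {in N, forall z, z <= Num.ceil x} &
      c + (Num.ceil x)%:~R + 1 - x <= (size N)%:R].

Lemma covers_start x : exists N, covers N x 0 /\
  {in N, forall z : int, `|z%:~R - x| < 1}.
Proof.
have /andP[c1 c2] := ceil_itv x.
have [xint|xint] := boolP (x \is a Num.int).
  have ex : (Num.ceil x)%:~R = x by apply/eqP; rewrite -intrEceil.
  exists [:: Num.ceil x]; split.
    split => //= [z|]; first by rewrite inE => /eqP ->.
    lra.
  move=> z; rewrite inE => /eqP ->.
  by move: c1; rewrite intrB/= => c1; rewrite ltr_norml; apply/andP; split; lra.
have cf : Num.ceil x = Num.floor x + 1 by rewrite ceil_floor xint.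
exists [:: Num.floor x; Num.ceil x]; split.
  split => /=.
  - by rewrite inE andbT cf lt_eqF// ltrDl.
  - by move=> z; rewrite !inE => /orP[]/eqP -> //; rewrite cf lerDl.
  - move: c1; rewrite intrB/=; lra.
have /andP[f1 f2] := floor_itv x.
move: c1 f2; rewrite intrB intrD/= => c1 f2.
by move=> z; rewrite !inE => /orP[]/eqP ->; rewrite ltr_norml; apply/andP; split; lra.
Qed.

(** If [ceil y] is [ceil x] or [ceil x + 1], no gap opens before y, and the length left of the
    current point grows by y - x >= d. If y lies farther, the whole part of the union right of x, of
    length at least 1, is now left of y and pays for the increment d <= 1. *)
Lemma covers_step N x y c d : covers N x c -> 0 <= d <= 1 -> x + d <= y ->
  exists N', covers N' y (c + d) /\
    {in N', forall z : int, z \in N \/ `|z%:~R - y| < 1}.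
Proof.
move=> [uN leN cN] /andP[d0 d1] xy.
have /andP[c1 c2] := ceil_itv x.
have /andP[c1' c2'] := ceil_itv y.
have /andP[f1 f2] := floor_itv y.
have cxy : Num.ceil x <= Num.ceil y by apply: le_ceil; lra.
move: c1 c1' f2; rewrite !intrB !intrD/= => c1 c1' f2.
have near_ceil : `|(Num.ceil y)%:~R - y| < 1.
  by rewrite ltr_norml; apply/andP; split; lra.
have near_floor : `|(Num.floor y)%:~R - y| < 1.
  by rewrite ltr_norml; apply/andP; split; lra.
have [e0|] := eqVneq (Num.ceil y) (Num.ceil x).
  exists N; split; last by left.
  split => //; first by move=> z /leN; rewrite e0.
  by rewrite e0; lra.
move=> /negP ne0.
have [e1|/negP ne1] := eqVneq (Num.ceil y) (Num.ceil x + 1).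
  exists (Num.ceil y :: N); split; last first.
    by move=> z; rewrite inE => /predU1P[->|]; [right|left].
  split => /=.
  - by rewrite uN andbT; apply/negP => /leN; rewrite e1 gerDl.
  - by move=> z; rewrite inE => /predU1P[->//|/leN] /le_trans; apply.
  - by rewrite e1 intrD -natr1; lra.
have e1 : Num.ceil x + 1 <= Num.ceil y.
  by rewrite lezD1 lt_neqAle cxy andbT eq_sym; apply/negP.
have e2 : Num.ceil x + 2 <= Num.ceil y.
  by rewrite -[2]/(1 + 1) addrA lezD1 lt_neqAle e1 andbT eq_sym; apply/negP.
have e2' : (Num.ceil x)%:~R + 2 <= (Num.ceil y)%:~R :> R.
  by move: e2; rewrite -(ler_int R) intrD.
have [yint|yint] := boolP (y \is a Num.int).
  have ey : (Num.ceil y)%:~R = y by apply/eqP; rewrite -intrEceil.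
  exists (Num.ceil y :: N); split; last first.
    by move=> z; rewrite inE => /predU1P[->|]; [right|left].
  split => /=.
  - by rewrite uN andbT; apply/negP => /leN; rewrite leNgt (lt_le_trans _ e2)// ltrDl.
  - by move=> z; rewrite inE => /predU1P[->//|/leN] /le_trans; apply.
  - by rewrite -natr1; lra.
have cf : Num.ceil y = Num.floor y + 1 by rewrite ceil_floor yint.
exists [:: Num.floor y, Num.ceil y & N]; split; last first.
  by move=> z; rewrite !inE => /or3P[/eqP->|/eqP->|]; [right|right|left].
split => /=.
- rewrite uN !inE negb_or andbT -andbA; apply/and3P; split.
  + by rewrite cf lt_eqF// ltrDl.
  + apply/negP => /leN; rewrite leNgt -(ltrD2r 1) -cf => /negP; apply.
    by rewrite (lt_le_trans _ e2)// ltrD2l.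
  + by apply/negP => /leN; rewrite leNgt (lt_le_trans _ e2)// ltrDl.
- move=> z; rewrite !inE => /or3P[/eqP->|/eqP->//|/leN h].
  + by rewrite cf lerDl.
  + exact: le_trans h _.
- by rewrite -2!natr1; lra.
Qed.

Lemma covers_path s N x c d : covers N x c -> 0 <= d <= 1 ->
  path (fun u v => u + d <= v) x s ->
  exists N', covers N' (last x s) (c + d * (size s)%:R) /\
    {in N', forall z : int, z \in N \/ exists2 y, y \in s & `|z%:~R - y| < 1}.
Proof.
elim: s N x c => [|y s IH] N x c cN d01 /=.
  by move=> _; exists N; rewrite mulr0 addr0; split => // z; left.
case/andP => xy ps.
have [N1 [cN1 N1P]] := covers_step cN d01 xy.
have [N2 [cN2 N2P]] := IH _ _ _ cN1 d01 ps.
exists N2; split.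
  by rewrite -natr1 mulrDr mulr1 (addrC (d * _)) addrA.
move=> z /N2P[/N1P[zN|zy]|[u us zu]].
- by left.
- by right; exists y => //; rewrite mem_head.
- by right; exists u => //; rewrite inE us orbT.
Qed.

(* The discrete Brunn-Minkowski inequality on the line: walk from the sum of
   the minima of A and B to the sum of the maxima, first through A with steps
   at least [1 - l], then through B with steps at least [l]. *)
Lemma discrete_brunn_minkowski (A B : seq int) (l : R) : 0 <= l <= 1 ->
  uniq A -> uniq B -> A != [::] -> B != [::] ->
  exists N, [/\ uniq N,
    {in N, forall z : int, exists a b, [/\ a \in A, b \in B &
      `|z%:~R - ((1 - l) * a%:~R + l * b%:~R)| < 1]} &
    (1 - l) * (size A)%:R + l * (size B)%:R <= (size N)%:R].
Proof.
move=> /andP[l0 l1] uA uB A0 B0.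
have := sort_lt_sorted A; rewrite uA => sA.
have := sort_lt_sorted B; rewrite uB => sB.
have memA := mem_sort <=%R A; have memB := mem_sort <=%R B.
have szA := size_sort <=%R A; have szB := size_sort <=%R B.
case: (sort <=%R A) sA memA szA => [|a s] sA memA szA.
  by move: A0; rewrite -size_eq0 -szA.
case: (sort <=%R B) sB memB szB => [|b t] sB memB szB.
  by move: B0; rewrite -size_eq0 -szB.
pose w (u v : int) : R := (1 - l) * u%:~R + l * v%:~R.
have stepA u v v' : u < v -> w u v' + (1 - l) <= w v v'.
  rewrite /w -lezD1 -(ler_int R) intrD => uv.
  have : 0 <= (1 - l) * (v%:~R - (u%:~R + 1)) by apply: mulr_ge0; lra.
  lra.
have stepB u v v' : u < v -> w v' u + l <= w v' v.
  rewrite /w -lezD1 -(ler_int R) intrD => uv.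
  have : 0 <= l * (v%:~R - (u%:~R + 1)) by apply: mulr_ge0; lra.
  lra.
have [N0 [cN0 N0P]] := covers_start (w a b).
have p1 : path (fun u v => u + (1 - l) <= v) (w a b) (map (w^~ b) s).
  by apply: (homo_path (f := w^~ b)) sA => u v; exact: stepA.
have [|N1 [cN1 N1P]] := covers_path cN0 _ p1; first by apply/andP; split; lra.
move: cN1; rewrite (last_map (w^~ b)) => cN1.
have p2 : path (fun u v => u + l <= v) (w (last a s) b) (map (w (last a s)) t).
  by apply: homo_path sB => u v; exact: stepB.
have [|N2 [[uN2 _ cN2] N2P]] := covers_path cN1 _ p2; first by apply/andP.
exists N2; split => //.
  move=> z /N2P[/N1P[/N0P zab|]|].
  - by exists a, b; rewrite -memA -memB !mem_head.
  - move=> [_ /mapP[u us ->] zu]; exists u, b.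
    by rewrite -memA -memB mem_head inE us orbT.
  - move=> [_ /mapP[u us ->] zu]; exists (last a s), u.
    by rewrite -memA -memB mem_last inE us orbT.
(* The walk has one step fewer than A has points, and likewise for B. The missing (1 - l) + l = 1 is
   the length of the union right of the endpoint, [ceil w + 1 - w >= 1]. *)
move: cN2; rewrite !size_map -szA -szB/= -!natr1 => cN2.
have := ceil_ge (last (w (last a s) b) [seq w (last a s) i | i <- t]).
move: cN2; lra.
Qed.

End integer_neighbours.

(** * From sets of integers to functions on the integers *)

Lemma near_floor_ceil (R : realType) (x : R) (z : int) : `|z%:~R - x| < 1 ->
  z \in [:: Num.floor x; Num.ceil x].
Proof.
rewrite ltr_norml => /andP[zx xz].
have zfloor : Num.floor x <= z.
  by rewrite -ltzD1 -(ltr_int R) intrD; have := floor_le x; lra.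
have zceil : z <= Num.ceil x.
  by rewrite -ltzD1 -(ltr_int R) intrD; have := ceil_ge x; lra.
rewrite !inE; have [->//|zf] := eqVneq z (Num.floor x).
rewrite eq_le zceil/= ceil_floor (@le_trans _ _ (Num.floor x + 1))//.
  by rewrite lerD2l; case: (x \isn't a Num.int).
by rewrite lezD1 lt_neqAle eq_sym zf.
Qed.

Lemma integral_ltr_indic (R : realType) (y : R) : 0 <= y <= 1 ->
  (\int[lebesgue_measure]_(t in `[0%R, 1%R[) ((t < y)%R%:R)%:E = y%:E)%E.
Proof.
move=> /andP[y0 y1].
transitivity (\int[lebesgue_measure]_(t in `[0%R, 1%R[) (\1_(`]-oo, y[) t)%:E)%E.
  by apply: eq_integral => t _; rewrite indicE mem_setE in_itv.
rewrite integral_indic//.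
rewrite (_ : _ `&` _ = `[0, y[%classic); last first.
  apply/seteqP; split => t /=; rewrite !in_itv/=.
    by move=> [ty /andP[-> _]].
  by move=> /andP[-> ty]; rewrite ty (lt_le_trans ty).
rewrite [LHS]lebesgue_measure_itv/= lte_fin sube0; case: ltP => //.
by move=> y0'; congr _%:E; apply: le_anti; rewrite y0 y0'.
Qed.

Lemma sum_layer (R : realType) (I : eqType) (s : seq I) (f : I -> R) :
  {in s, forall i, 0 <= f i <= 1} ->
  (\int[lebesgue_measure]_(t in `[0%R, 1%R[)
    (\sum_(i <- s) (t < f i)%R%:R)%R%:E = (\sum_(i <- s) f i)%R%:E)%E.
Proof.
move=> f01.
under eq_integral do rewrite -sumEFin.
have mlt y : measurable_fun [set: R] (fun t : R => (t < y)%R%:R : R).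
  rewrite (_ : (fun _ => _) = \1_(`]-oo, y[)).
    exact: measurable_indic.
  by apply/funext => t; rewrite indicE mem_setE in_itv.
rewrite ge0_integral_sum//; last first.
- by move=> i; apply/measurable_EFinP; apply: measurable_funTS; exact: mlt.
rewrite -sumEFin; apply: eq_big_seq => i si.
by rewrite integral_ltr_indic// f01.
Qed.

Section prekopa_leindler_int.
Context {R : realType} (l : R) (l01 : 0 < l < 1).

Definition near_int (x y z : int) := `|z%:~R - ((1 - l) * x%:~R + l * y%:~R)| < 1.

(** Both maxima equal 1, so at every level t < 1 the superlevel sets of f and g are nonempty, as the
    discrete Brunn-Minkowski inequality requires. Applying it at each level and integrating over t
    in [0, 1[ gives the sums. *)
Lemma sum_near_int (S T U : seq int) (f g k : int -> R) (x0 y0 : int) :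
  uniq S -> uniq T -> uniq U ->
  {in S, forall x, 0 <= f x <= 1} -> {in T, forall y, 0 <= g y <= 1} ->
  {in U, forall z, 0 <= k z <= 1} ->
  x0 \in S -> f x0 = 1 -> y0 \in T -> g y0 = 1 ->
  (forall x y z : int, x \in S -> y \in T -> near_int x y z ->
     z \in U /\ Num.min (f x) (g y) <= k z) ->
  (1 - l) * (\sum_(x <- S) f x) + l * (\sum_(y <- T) g y) <= \sum_(z <- U) k z.
Proof.
move=> uS uT uU f01 g01 k01 Sx0 fx0 Ty0 gy0 fgk.
have /andP[l0 l1] := l01.
have count t : 0 <= t < 1 ->
    (1 - l) * (\sum_(x <- S) (t < f x)%R%:R) + l * (\sum_(y <- T) (t < g y)%R%:R)
    <= \sum_(z <- U) (t < k z)%R%:R.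
  move=> /andP[t0 t1].
  have sumE (s : seq int) (h : int -> R) :
      \sum_(x <- s) (t < h x)%R%:R = (size [seq x <- s | t < h x])%:R :> R.
    rewrite -natr_sum size_filter; congr _%:R.
    by elim: s => [|x s IH]; rewrite ?big_nil// big_cons IH.
  rewrite !sumE.
  have [|||||N [uN Nnear]] := @discrete_brunn_minkowski R
      [seq x <- S | t < f x] [seq y <- T | t < g y] l.
  - by rewrite (ltW l0) ltW.
  - exact: filter_uniq.
  - exact: filter_uniq.
  - by apply/eqP => S0; have := mem_filter (fun x => t < f x) x0 S; rewrite S0 fx0 t1 Sx0.
  - by apply/eqP => S0; have := mem_filter (fun x => t < g x) y0 T; rewrite S0 gy0 t1 Ty0.
  move=> /le_trans; apply; rewrite ler_nat.
  apply: uniq_leq_size => // z /Nnear[x [y []]].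
  rewrite !mem_filter => /andP[tf Sx] /andP[tg Ty] zxy.
  have [zU] := fgk _ _ _ Sx Ty zxy.
  by rewrite ge_min zU andbT => /orP[|]; exact: lt_le_trans.
rewrite -lee_fin EFinD !EFinM -!sum_layer//.
have mlt (s : seq int) (h : int -> R) :
    measurable_fun [set: R] (fun t : R => \sum_(x <- s) (t < h x)%R%:R : R).
  apply: measurable_sum => x.
  rewrite (_ : (fun _ => _) = \1_(`]-oo, h x[)); first exact: measurable_indic.
  by apply/funext => t; rewrite indicE mem_setE in_itv.
have sum0 (s : seq int) (h : int -> R) t : (0 <= (\sum_(x <- s) (t < h x)%R%:R)%R%:E :> \bar R)%E.
  by rewrite lee_fin sumr_ge0.
have Zl (c : R) (s : seq int) (h : int -> R) : 0 <= c ->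
    (c%:E * \int[lebesgue_measure]_(t in `[0%R, 1%R[)
      (\sum_(x <- s) (t < h x)%R%:R)%R%:E =
    \int[lebesgue_measure]_(t in `[0%R, 1%R[)
      (c%:E * (\sum_(x <- s) (t < h x)%R%:R)%R%:E))%E.
  move=> c0; rewrite ge0_integralZl_EFin//.
  by apply: measurable_funTS; apply/measurable_EFinP; exact: mlt.
rewrite (Zl (1 - l)); last by rewrite subr_ge0 ltW.
rewrite (Zl l); last exact: ltW.
rewrite -ge0_integralD//.
- apply: ge0_le_integral => //.
  + by move=> t _; rewrite adde_ge0// mule_ge0// lee_fin ?subr_ge0 ltW.
  + apply: measurable_funTS; apply: emeasurable_funD; apply: measurable_funeM; apply/measurable_EFinP; exact: mlt.
  + by apply: measurable_funTS; apply/measurable_EFinP; exact: mlt.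
- by move=> t _; rewrite mule_ge0// lee_fin subr_ge0 ltW.
- by apply: measurable_funTS; apply: measurable_funeM; apply/measurable_EFinP; exact: mlt.
- by move=> t _; rewrite mule_ge0// lee_fin ltW.
- by apply: measurable_funTS; apply: measurable_funeM; apply/measurable_EFinP; exact: mlt.
Qed.

End prekopa_leindler_int.

(** * The discrete Prekopa-Leindler inequality *)

Lemma weighted_am_gm (R : realType) (l u v : R) : 0 < l < 1 -> 0 <= u -> 0 <= v ->
  u `^ (1 - l) * v `^ l <= (1 - l) * u + l * v.
Proof.
move=> /andP[l0 l1] u0 v0.
have l'0 : 0 < 1 - l by rewrite subr_gt0.
have := @conjugate_powR R (u `^ (1 - l)) (v `^ l) (1 - l)^-1 l^-1.
rewrite !powR_ge0 !invr_gt0 !invrK subrK -!powRrM !divff ?gt_eqF// !powRr1//.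
by rewrite (mulrC u) (mulrC v); apply.
Qed.

Lemma esum_gt_seq (R : realType) (X : choiceType) (F : X -> \bar R) (a : \bar R) :
  (a < \esum_(x in setT) F x)%E ->
  exists2 s : seq X, uniq s & (a < \sum_(x <- s) F x)%E.
Proof.
move=> /ereal_sup_gt[_ [A [finA _] <-]] aA.
by exists (finmap.enum_fset (fset_set A)); [exact: finmap.fset_uniq|rewrite -fsbig_finite].
Qed.

Lemma le_esum_seq (R : realType) (X : choiceType) (F : X -> \bar R) (s : seq X) :
  uniq s -> (\sum_(x <- s) F x <= \esum_(x in setT) F x)%E.
Proof.
move=> us; apply: esum_ge; exists [set` s].
  by split => //; exact: finite_seq.
by rewrite -fsbig_seq.
Qed.

Lemma seq_argmax (R : realDomainType) (X : eqType) (f : X -> R) (s : seq X) :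
  s != [::] -> exists2 x0, x0 \in s & {in s, forall x, f x <= f x0}.
Proof.
elim: s => // x s IH _; have [->|/IH[x0 sx0 x0P]] := eqVneq s [::].
  by exists x; rewrite ?mem_head// => y; rewrite inE => /eqP ->.
have [fxx0|fx0x] := leP (f x) (f x0).
  by exists x0; [rewrite inE sx0 orbT|move=> y; rewrite inE => /predU1P[->//|/x0P]].
exists x; first by rewrite mem_head.
by move=> y; rewrite inE => /predU1P[->//|/x0P/le_trans]; apply; exact: ltW.
Qed.

Section prekopa_leindler.
Context {R : realType} (l : R) (l01 : 0 < l < 1).

(* [u^(1-l) * v^l <= w] without powers of infinity; the strict inequalities let
   the conclusion for one coordinate serve as the hypothesis for the next. *)
Definition geometric_mean_le (u v w : \bar R) := forall a b : R,
  0 < a -> 0 < b -> (a%:E < u)%E -> (b%:E < v)%E ->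
  ((a `^ (1 - l) * b `^ l)%:E <= w)%E.

Definition prekopa_leindler (X : choiceType) (near : X -> X -> X -> Prop) :=
  forall F G K : X -> \bar R,
  (forall x, 0 <= F x)%E -> (forall x, 0 <= G x)%E -> (forall x, 0 <= K x)%E ->
  (\esum_(x in setT) F x < +oo)%E -> (\esum_(x in setT) G x < +oo)%E ->
  (forall x y z, near x y z -> geometric_mean_le (F x) (G y) (K z)) ->
  geometric_mean_le (\esum_(x in setT) F x) (\esum_(x in setT) G x)
    (\esum_(x in setT) K x).

Lemma esum_lty_fin_num (X : choiceType) (F : X -> \bar R) :
  (forall x, 0 <= F x)%E -> (\esum_(x in setT) F x < +oo)%E ->
  forall x, F x \is a fin_num.
Proof.
move=> F0 Foo x; rewrite ge0_fin_numE//; apply: le_lt_trans Foo.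
by have := le_esum_seq F (s := [:: x]) isT; rewrite big_seq1.
Qed.

(* Scaling F turns strict inequality of the sums into strict inequality of the
   summands. *)
Lemma esum_gt_minorant (X : choiceType) (F : X -> \bar R) (a : R) :
  (forall x, 0 <= F x)%E -> (\esum_(x in setT) F x < +oo)%E ->
  0 < a -> (a%:E < \esum_(x in setT) F x)%E ->
  exists s : seq X, exists f : X -> R,
  [/\ uniq s, forall x, 0 <= f x, forall x, 0 < f x -> ((f x)%:E < F x)%E &
      \sum_(x <- s) f x = a].
Proof.
move=> F0 Foo a0 /esum_gt_seq[s us]; have Ffin := esum_lty_fin_num F0 Foo.
rewrite (eq_bigr (fun x => (fine (F x))%:E)); last by move=> x _; rewrite fineK.
rewrite sumEFin lte_fin; set A := \sum_(x <- s) _ => aA.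
have A0 : 0 < A by exact: lt_trans aA.
exists s, (fun x => fine (F x) * (a / A)); split => //.
- by move=> x; rewrite mulr_ge0 ?fine_ge0// divr_ge0// ltW.
- move=> x; rewrite pmulr_lgt0 ?divr_gt0// => Fx0.
  by rewrite -[ltRHS]fineK// lte_fin gtr_pMr// ltr_pdivrMr// mul1r.
- by rewrite -mulr_suml mulrCA divff ?mulr1// gt_eqF.
Qed.

Lemma prekopa_leindler_int : prekopa_leindler (near_int l).
Proof.
move=> F G K F0 G0 K0 Foo Goo FGK a b a0 b0 aF bG.
have /andP[l0 l1] := l01.
have l'0 : 0 < 1 - l by rewrite subr_gt0.
have [S [f [uS f0 fF fa]]] := esum_gt_minorant F0 Foo a0 aF.
have [T [g [uT g0 gG gb]]] := esum_gt_minorant G0 Goo b0 bG.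
have argmax (s : seq int) (h : int -> R) c : 0 < c -> (forall x, 0 <= h x) ->
    \sum_(x <- s) h x = c ->
    exists2 x0, x0 \in s & 0 < h x0 /\ {in s, forall x, h x <= h x0}.
  move=> c0 h0 hc; have [|x0 sx0 x0P] := @seq_argmax R _ h s.
    by apply/eqP => s0; move: hc c0; rewrite s0 big_nil => <-; rewrite ltxx.
  exists x0 => //; split => //; rewrite lt_neqAle h0 andbT; apply/eqP => hx0.
  move: c0; rewrite -hc big_seq big1 ?ltxx// => x /x0P.
  by rewrite -hx0 => hx; apply: le_anti; rewrite hx h0.
have [x0 Sx0 [fx0 x0P]] := argmax _ _ _ a0 f0 fa.
have [y0 Ty0 [gy0 y0P]] := argmax _ _ _ b0 g0 gb.
set al := f x0 in fx0 x0P; set be := g y0 in gy0 y0P.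
pose ka := al `^ (1 - l) * be `^ l.
have ka0 : 0 < ka by rewrite mulr_gt0// powR_gt0.
(* K may be infinite or exceed [ka], while the normalized function must stay below 1. Truncating at
   [ka] is harmless, since f(x)^(1-l) g(y)^l never exceeds [ka]. *)
pose k z := fine (mine (K z) ka%:E) / ka.
have Kfin z : mine (K z) ka%:E \is a fin_num.
  rewrite ge0_fin_numE; first by rewrite gt_min ltry orbT.
  by rewrite le_min K0 lee_fin ltW.
have k0 z : 0 <= k z.
  by rewrite divr_ge0// ?(ltW ka0)// fine_ge0// le_min K0 lee_fin ltW.
pose w x y : R := (1 - l) * x%:~R + l * y%:~R.
(* An integer near a combination of x and y is its floor or its ceiling, so finitely many candidates
   suffice. *)
pose U := undup (flatten [seq [:: Num.floor (w x y); Num.ceil (w x y)] | x <- S, y <- T]).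
have := @sum_near_int R l l01 S T U (fun x => f x / al) (fun y => g y / be) k x0 y0
  uS uT (undup_uniq _).
rewrite -mulr_suml fa -mulr_suml gb => H.
have {H} : (1 - l) * (a / al) + l * (b / be) <= \sum_(z <- U) k z.
  apply: H => //.
  - by move=> x /x0P xS; rewrite divr_ge0 ?(ltW fx0)//= ler_pdivrMr// mul1r.
  - by move=> x /y0P xS; rewrite divr_ge0 ?(ltW gy0)//= ler_pdivrMr// mul1r.
  - move=> z _; rewrite k0/= ler_pdivrMr// mul1r -lee_fin fineK//.
    by rewrite ge_min lexx orbT.
  - by rewrite divff// gt_eqF.
  - by rewrite divff// gt_eqF.
  move=> x y z Sx Ty xyz; split.
    rewrite mem_undup; apply/flattenP.
    exists [:: Num.floor (w x y); Num.ceil (w x y)]; first exact: allpairs_f.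
    exact: near_floor_ceil.
  set u := f x / al; set v := g y / be.
  have [fx|fx] := leP (f x) 0.
    by rewrite ge_min (le_trans _ (k0 z))// /u pmulr_lle0 ?invr_gt0.
  have [gy|gy] := leP (g y) 0.
    by rewrite ge_min orbC (le_trans _ (k0 z))// /v pmulr_lle0 ?invr_gt0.
  have u0 : 0 < u by rewrite divr_gt0.
  have v0 : 0 < v by rewrite divr_gt0.
  have fE : f x = u * al by rewrite /u divfK ?gt_eqF.
  have gE : g y = v * be by rewrite /v divfK ?gt_eqF.
  have u1 : u <= 1 by rewrite ler_pdivrMr// mul1r x0P.
  have v1 : v <= 1 by rewrite ler_pdivrMr// mul1r y0P.
  have uv : Num.min u v <= u `^ (1 - l) * v `^ l.
    have m0 : 0 <= Num.min u v by rewrite le_min !ltW.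
    rewrite -[leLHS](powRr1 m0) -[X in _ `^ X <= _](subrK l 1) powRD; last first.
      by apply/implyP; rewrite subrK oner_eq0.
    apply: ler_pM; rewrite ?powR_ge0//.
    - by rewrite ge0_ler_powR ?nnegrE ?(ltW l'0) ?(ltW u0)// ge_min lexx.
    - by rewrite ge0_ler_powR ?nnegrE ?(ltW l0) ?(ltW v0)// ge_min lexx orbT.
  apply: (le_trans uv).
  rewrite ler_pdivlMr// -lee_fin fineK//.
  have -> : u `^ (1 - l) * v `^ l * ka = f x `^ (1 - l) * g y `^ l.
    rewrite fE gE (powRM _ (ltW u0) (ltW fx0)) (powRM _ (ltW v0) (ltW gy0)).
    by rewrite mulrACA.
  rewrite le_min; apply/andP; split; first by apply: FGK xyz _ _ _ _ _ _; rewrite ?fF ?gG.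
  rewrite lee_fin; apply: ler_pM; rewrite ?powR_ge0//.
  - by rewrite ge0_ler_powR ?nnegrE ?(ltW l'0) ?(ltW fx) ?(ltW fx0)// x0P.
  - by rewrite ge0_ler_powR ?nnegrE ?(ltW l0) ?(ltW gy) ?(ltW gy0)// y0P.
move=> sumk.
apply: (@le_trans _ _ (\sum_(z <- U) K z)%E); last exact/le_esum_seq/undup_uniq.
apply: (@le_trans _ _ (\sum_(z <- U) (ka * k z)%:E)%E); last first.
  apply: lee_sum => z _; rewrite /k mulrCA divff ?gt_eqF// mulr1 fineK//.
  by rewrite ge_min lexx.
rewrite sumEFin lee_fin -mulr_sumr.
(* The arithmetic mean bound for the normalized sums is weakened to a geometric one, which is
   homogeneous: multiplying by [ka] restores a and b. *)
have aE : a = a / al * al by rewrite divfK ?gt_eqF.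
have bE : b = b / be * be by rewrite divfK ?gt_eqF.
have u0 : 0 <= a / al by rewrite divr_ge0// ltW.
have v0 : 0 <= b / be by rewrite divr_ge0// ltW.
rewrite aE bE (powRM _ u0 (ltW fx0)) (powRM _ v0 (ltW gy0)) mulrACA mulrC.
by rewrite ler_pM2l//; apply: le_trans sumk; exact: weighted_am_gm.
Qed.

End prekopa_leindler.

(** * Tensorization over the coordinates *)

Section prekopa_leindler_product.
Context {R : realType} (l : R).

(** Summing over the first coordinate leaves functions of the second one. For fixed second
    coordinates, [plX] applied to the fibers yields exactly the pointwise hypothesis of [plY];
    fibers have finite sums because the total sums are finite. *)
Lemma prekopa_leindler_prod (X Y : choiceType) (nearX : X -> X -> X -> Prop)
    (nearY : Y -> Y -> Y -> Prop) :
  prekopa_leindler l nearX -> prekopa_leindler l nearY ->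
  prekopa_leindler l (fun x y z : X * Y =>
    nearX x.1 y.1 z.1 /\ nearY x.2 y.2 z.2).
Proof.
move=> plX plY F G K F0 G0 K0.
have esumE (H : X * Y -> \bar R) : (forall x, 0 <= H x)%E ->
    (\esum_(x in setT) H x = \esum_(y in setT) \esum_(x in setT) H (x, y))%E.
  move=> H0; rewrite (@esum_esum _ _ _ setT (fun=> setT) (fun y x => H (x, y)))//.
  rewrite (reindex_esum (setT `*`` fun=> setT) setT (fun p : Y * X => (p.2, p.1)))//.
  split => //.
  - by move=> [? ?] [? ?] _ _ [-> ->].
  - by move=> [x y] _; exists (y, x).
rewrite !esumE// => Foo Goo FGK.
have fib0 (H : X * Y -> \bar R) y : (forall x, 0 <= H x)%E ->
    (0 <= \esum_(x in setT) H (x, y))%E by move=> H0; exact: esum_ge0.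
apply: plY => // [y|y|y|x2 y2 z2 near2]; [exact: fib0..|].
have fin (H : X * Y -> \bar R) y : (forall x, 0 <= H x)%E ->
    (\esum_(y in setT) \esum_(x in setT) H (x, y) < +oo)%E ->
    (\esum_(x in setT) H (x, y) < +oo)%E.
  move=> H0 Hoo; rewrite ltey_eq.
  by rewrite (esum_lty_fin_num (F := fun y => \esum_(x in setT) H (x, y))%E)// => y';
    exact: fib0.
apply: plX => //; [exact: fin|exact: fin|].
by move=> x1 y1 z1 near1; exact: FGK.
Qed.

Lemma prekopa_leindler_bij (X Y : choiceType) (e : X -> Y)
    (nearX : X -> X -> X -> Prop) (nearY : Y -> Y -> Y -> Prop) :
  bijective e ->
  (forall x y z, nearX x y z -> nearY (e x) (e y) (e z)) ->
  prekopa_leindler l nearX -> prekopa_leindler l nearY.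
Proof.
move=> [e' eK e'K] nearXY plX F G K F0 G0 K0.
have esumE (H : Y -> \bar R) : (forall x, 0 <= H x)%E ->
    (\esum_(y in setT) H y = \esum_(x in setT) H (e x))%E.
  move=> H0; rewrite (reindex_esum setT setT e)//; split => //.
  - by move=> x y _ _; exact: (can_inj eK).
  - by move=> y _; exists (e' y).
rewrite !esumE// => Foo Goo FGK; apply: plX => // x y z xyz.
exact/FGK/nearXY.
Qed.

End prekopa_leindler_product.

Section prekopa_leindler_rV.
Context {R : realType} (l : R) (l01 : 0 < l < 1).

Lemma prekopa_leindler_rV n : prekopa_leindler l
  (fun x y z : 'rV[int]_n => forall i, near_int l (x 0 i) (y 0 i) (z 0 i)).
Proof.
elim: n => [|n IH].
  (* The space has a single point, the sums are single values, and nearness holds vacuously. *)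
  move=> F G K F0 G0 K0 _ _ FGK.
  have -> : [set: 'rV[int]_0] = [set 0].
    by apply/seteqP; split => // x _; apply/rowP => -[].
  by rewrite !esum_set1//; apply: FGK => -[].
apply: (prekopa_leindler_bij
    (e := fun p : int * 'rV[int]_n => row_mx (const_mx p.1) p.2 : 'rV_(1 + n))
    _ _ (prekopa_leindler_prod (prekopa_leindler_int l01) IH)).
  exists (fun u : 'rV_(1 + n) => (lsubmx u 0 0, rsubmx u)) => [[i v]|u].
    by rewrite row_mxKl row_mxKr mxE.
  rewrite /= -[RHS](@hsubmxK _ 1 1 n); congr row_mx.
  by apply/rowP => i; rewrite !mxE ord1.
move=> [x1 x2] [y1 y2] [z1 z2] [/= near1 near2].
suff : forall i : 'I_(1 + n), near_int l (row_mx (const_mx x1 : 'rV_1) x2 0 i)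
    (row_mx (const_mx y1 : 'rV_1) y2 0 i) (row_mx (const_mx z1 : 'rV_1) z2 0 i).
  exact.
move=> i; case: (split_ordP i) => j ->; first by rewrite !row_mxEl !mxE.
by rewrite !row_mxEr.
Qed.

Lemma esum_Zn n (F : 'rV[R]_n -> \bar R) : (forall x, 0 <= F x)%E ->
  (\esum_(x in @Zn R n) F x = \esum_(x in setT) F (map_mx intr x))%E.
Proof.
move=> F0; rewrite (reindex_esum setT (@Zn R n) (map_mx intr))//; split.
- by move=> x _ i; rewrite mxE intr_int.
- by move=> x y _ _ /rowP xy; apply/rowP => i; have := xy i; rewrite !mxE => /intr_inj.
- move=> x xZ; exists (map_mx Num.floor x) => //.
  by apply/rowP => i; rewrite !mxE -[RHS]floorK.
Qed.

Lemma prekopa_leindler_Zn n (F G K : 'rV[R]_n -> \bar R) :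
  (forall x, 0 <= F x)%E -> (forall x, 0 <= G x)%E -> (forall x, 0 <= K x)%E ->
  (\esum_(x in @Zn R n) F x < +oo)%E -> (\esum_(x in @Zn R n) G x < +oo)%E ->
  (forall x y z, Zn x -> Zn y -> Zn z ->
     (forall i, `|z 0 i - ((1 - l) * x 0 i + l * y 0 i)| < 1) ->
     geometric_mean_le l (F x) (G y) (K z)) ->
  geometric_mean_le l (\esum_(x in @Zn R n) F x) (\esum_(x in @Zn R n) G x)
    (\esum_(x in @Zn R n) K x).
Proof.
move=> F0 G0 K0; rewrite !esum_Zn// => Foo Goo FGK.
have ZZ (x : 'rV[int]_n) : @Zn R n (map_mx intr x) by move=> i; rewrite mxE intr_int.
apply: (@prekopa_leindler_rV n) => // x y z near.
by apply: FGK => // i; rewrite !mxE; exact: near.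
Qed.

End prekopa_leindler_rV.

(** * The measure nu *)

Section lattice_measure.
Context {R : realType} (n : nat).

(** [pickle] numbers the lattice points, so a fiber has at most one point, and integrals over the
    lattice split into series indexed by k. *)
Definition Zn_fiber (k : nat) : set (discreteRn R n) :=
  [set x | Zn x /\ pickle (map_mx Num.floor (x : 'rV[R]_n)) = k].

Lemma bigcup_Zn_fiber : \bigcup_k Zn_fiber k = @Zn R n.
Proof.
apply/seteqP; split => [x [k _ []]//|x Zx].
by exists (pickle (map_mx Num.floor (x : 'rV[R]_n))).
Qed.

Lemma trivIset_Zn_fiber : trivIset setT Zn_fiber.
Proof. by move=> i j _ _ [x [[_ <-] [_ <-]]]. Qed.

Lemma Zn_fiber_inj k x y : Zn_fiber k x -> Zn_fiber k y -> x = y.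
Proof.
move=> [xZ <-] [yZ /(pcan_inj pickleK)/rowP xy]; apply/rowP => i.
have := xy i; rewrite !mxE => e.
by rewrite -(floorK (xZ i)) -(floorK (yZ i)) e.
Qed.

Lemma Zn_fiberP k : Zn_fiber k = set0 \/ exists2 x, Zn x & Zn_fiber k = [set x].
Proof.
have [[x kx]|k0] := pselect (exists x, Zn_fiber k x).
  right; exists x; first by case: kx.
  apply/seteqP; split => [y ky /=|y ->//].
  exact: Zn_fiber_inj ky kx.
by left; apply/seteqP; split => // x kx; case: k0; exists x.
Qed.

Lemma lattice_enum_set1 (x : discreteRn R n) : Zn x -> lattice_enum R n [set x] = 1%E.
Proof.
move=> Zx; rewrite /lattice_enum /= /mrestr setIidl; last by move=> _ ->.
by rewrite /counting/= asboolT// fset_set1 finmap.cardfs1.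
Qed.

Lemma sigma_finite_lattice_enum : sigma_finite setT (lattice_enum R n).
Proof.
(* The complement of the lattice is null; joined to every fiber, it lets the pieces exhaust the
   space without changing their measure. *)
exists (fun k => ~` @Zn R n `|` Zn_fiber k).
  apply/seteqP; split => // x _; have [Zx|Zx] := pselect (@Zn R n x).
    by move: (Zx); rewrite -bigcup_Zn_fiber => -[k _ kx]; exists k => //; right.
  by exists 0%N => //; left.
move=> k; split => //.
rewrite /lattice_enum /= /mrestr setIUl setICl set0U.
have [->|[x Zx ->]] := Zn_fiberP k; first by rewrite set0I measure0.
by have := lattice_enum_set1 Zx; rewrite /lattice_enum/= /mrestr => ->; exact: ltry.
Qed.

Lemma integral_lattice_enum (g : discreteRn R n -> \bar R) : (forall x, 0 <= g x)%E ->
  (\int[lattice_enum R n]_x g x = \esum_(x in @Zn R n) g x)%E.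
Proof.
move=> g0.
have mg D : measurable_fun D g by move=> ? Y mY.
rewrite (ge0_negligible_integral (N := ~` @Zn R n))//; last first.
  by rewrite /lattice_enum/= /mrestr setICl measure0.
rewrite setDE setCK setTI -bigcup_Zn_fiber ge0_integral_bigcup//; last first.
  exact: trivIset_Zn_fiber.
rewrite esum_bigcupT//; last exact: trivIset_Zn_fiber.
rewrite nneseries_esumT; last by move=> k; apply: integral_ge0.
apply: eq_esum => k _.
have [->|[x Zx ->]] := Zn_fiberP k; first by rewrite integral_set0 esum_set0.
rewrite esum_set1// (eq_integral (cst (g x))); last by move=> y; rewrite inE => ->.
by rewrite integral_cst// lattice_enum_set1// mule1.
Qed.

Lemma nuE (A : set (discreteRn R n * measurableTypeR R)) :
  nu R n A = (\esum_(x in @Zn R n) expdt R (xsection A x))%E.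
Proof. by rewrite -integral_lattice_enum. Qed.

End lattice_measure.

Section expdt.
Context {R : realType}.

Lemma expdt_itvcy (t : R) : 0 <= t ->
  expdt R (`[t, +oo[%classic : set (measurableTypeR R)) = (expR (- t))%:E.
Proof.
move=> t0; rewrite /expdt/= /exponential_prob.
have cE : continuous (fun x : R^o => expR (- 1 * x)).
  move=> x; apply: continuous_comp; last exact: continuous_expR.
  by apply: continuousM => //; apply: (@continuousN _ R^o); exact: cst_continuous.
rewrite (@ge0_continuous_FTC2y _ _ (fun x => - expR (- 1 * x)) _ 0).
- by rewrite mulN1r EFinN oppeK add0e.
- by move=> x _; exact: exponential_pdf_ge0.
- apply: (@continuous_subspaceW R^o _ _ [set` `[0, +oo[%R]).
    by apply: subset_itvr; rewrite bnd_simp.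
  exact: within_continuous_exponential_pdf.
- rewrite -oppr0; apply: cvgN.
  under eq_fun do rewrite mulN1r.
  exact: cvgr_expR.
- by move=> x _; exact: ex_derive.
- by apply/cvg_at_right_filter; apply: cvgN; exact: cE.
- move=> x; rewrite in_itv/= andbT => tx.
  by apply: derive1_exponential_pdf; rewrite in_itv/= andbT (le_lt_trans t0).
Qed.

Lemma expdt_itvoy (t : R) : 0 <= t ->
  expdt R (`]t, +oo[%classic : set (measurableTypeR R)) = (expR (- t))%:E.
Proof.
move=> t0; rewrite -expdt_itvcy// /expdt/= /exponential_prob.
apply: integral_itv_obnd_cbnd; apply: measurable_funTS; apply/measurable_EFinP.
exact: measurable_exponential_pdf.
Qed.

End expdt.

Lemma sigma_finite_nu (R : realType) (n : nat) : sigma_finite setT (nu R n).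
Proof.
have [F FT Foo] := @sigma_finite_lattice_enum R n.
exists (fun k => F k `*` setT).
  rewrite -setXTT FT; apply/seteqP; split => [[x t] /= [[k _ Fk] _]|[x t] /= [k _ [Fk _]]].
    by exists k.
  by split => //; exists k.
move=> k; have [mF Fk] := Foo k; split; first exact: measurableX.
have -> : nu R n (F k `*` setT) = (lattice_enum R n (F k) * expdt R setT)%E.
  exact: product_measure1E.
by rewrite probability_setT mule1.
Qed.

(* A copy of [nu] that carries the sigma-finite structure needed by Tonelli. *)
Definition nu_measure (R : realType) (n : nat) :
  set (discreteRn R n * measurableTypeR R) -> \bar R := nu R n.
HB.instance Definition _ R n := Measure.on (@nu_measure R n).
HB.instance Definition _ R n :=
  Measure_isSigmaFinite.Build _ _ _ (@nu_measure R n) (sigma_finite_nu R n).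

Lemma integral_powR_layer (R : realType) (al y : R) : 1 <= al -> 0 <= y ->
  (\int[lebesgue_measure]_(r in `]0%R, y[) (al * r `^ (al - 1))%:E = (y `^ al)%:E)%E.
Proof.
move=> al1; rewrite le_eqVlt => /predU1P[<-|y0].
  rewrite set_itvoo0 integral_set0 powR0// gt_eqF//; exact: lt_le_trans al1.
have al0 : 0 < al by exact: lt_le_trans al1.
have cpow (b x : R) : 0 < x -> {for x, continuous (fun r : R => r `^ b : R^o)}.
  move=> x0; apply: differentiable_continuous; apply/derivable1_diffP.
  by apply: derivable_powR; rewrite in_itv/= x0.
have mw : measurable_fun [set: R] (fun r : R => al * r `^ (al - 1)).
  apply: measurable_funM => //; exact: measurable_powR.
have mwE D : measurable_fun D (fun r : R => (al * r `^ (al - 1))%:E).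
  by apply: measurable_funTS; apply/measurable_EFinP.
rewrite integral_itv_bndo_bndc// integral_itv_obnd_cbnd//.
rewrite (@continuous_FTC2 _ _ (fun r => r `^ al))//.
- by rewrite powR0 ?gt_eqF// sube0.
- apply/continuous_within_itvP => //; split.
  + move=> x; rewrite in_itv/= => /andP[x0 _].
    by apply: cvgM; [exact: cvg_cst|exact: cpow].
  (* For al = 1 the weight is the constant 1, because 0 to the power 0 is 1; for al > 1 it vanishes
     at 0. Continuity at 0 thus has two different reasons. *)
  + have [->|al1'] := eqVneq al 1.
      under eq_fun do rewrite subrr powRr0; rewrite subrr powRr0; exact: cvg_cst.
    rewrite powR0 ?subr_eq0//.
    apply: cvgM; first exact: cvg_cst.
    by apply: powR_cvg0; rewrite subr_gt0 lt_neqAle eq_sym al1'.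
  + apply: cvg_at_left_filter; apply: cvgM; first exact: cvg_cst.
    exact: cpow.
- split.
  + by move=> x; rewrite in_itv/= => /andP[x0 _]; apply: derivable_powR; rewrite in_itv/= x0.
  + by rewrite powR0 ?gt_eqF//; exact: powR_cvg0.
  + by apply: cvg_at_left_filter; exact: cpow.
- by move=> x; rewrite in_itv/= => /andP[x0 _]; apply: powR_derive1; rewrite in_itv/= x0.
Qed.

(** * Layer cake formulas and the crossing argument *)

Section layer_cake.
Context d (T : measurableType d) (R : realType).
Variable mu : {sigma_finite_measure set T -> \bar R}.

(** Tonelli's theorem for the product weight on the region under the graph of g. The weight v serves
    the Gamma integral, and the extended values of g serve the Asplund product. Measurability is
    asked of the region itself, which is what the superlevel sets provide. *)
Lemma integral_superlevel (D : set T) (g : T -> \bar R) (v : T -> R) (w : R -> R) :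
  (forall x, 0 <= v x) -> measurable_fun setT v ->
  (forall r, 0 <= w r) -> measurable_fun setT w ->
  measurable [set p : T * measurableTypeR R | [/\ D p.1, 0 < p.2 & (p.2%:E < g p.1)%E]] ->
  (\int[mu]_(x in D) ((v x)%:E *
     \int[lebesgue_measure]_(r in [set r | (0 < r)%R /\ (r%:E < g x)%E]) (w r)%:E) =
   \int[lebesgue_measure]_(r in `]0%R, +oo[) ((w r)%:E *
     \int[mu]_(x in [set x | D x /\ (r%:E < g x)%E]) (v x)%:E))%E.
Proof.
move=> v0 mv w0 mw mE; set E := [set p | _] in mE.
pose f := (fun p : T * measurableTypeR R => (v p.1 * w p.2)%:E) \_ E.
have f0 p : (0 <= f p)%E by apply: erestrict_ge0 => ? _; rewrite lee_fin mulr_ge0.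
have mf : measurable_fun setT f.
  apply/(measurable_restrict _ mE measurableT); rewrite setTI.
  apply: measurable_funTS; apply/measurable_EFinP; apply: measurable_funM.
    exact: (measurableT_comp mv).
  exact: (measurableT_comp mw).
have Fub := fubini_tonelli (m1 := mu)
  (m2 := @lebesgue_measure R : {sigma_finite_measure set (measurableTypeR R) -> \bar R}) f mf f0.
rewrite integral_mkcond.
transitivity (\int[mu]_x \int[lebesgue_measure]_r f (x, r))%E.
  apply: eq_integral => x _; rewrite patchE; case: ifPn => [/set_mem Dx|/negP Dx].
    have -> : [set r | 0 < r /\ (r%:E < g x)%E] = xsection E x.
      by apply/seteqP; split => r; rewrite /xsection/= inE => -[]//; split.
    have mx := measurable_xsection x mE.
    rewrite -ge0_integralZl//.
    - rewrite integral_mkcond; apply: eq_integral => r _.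
      by rewrite /f !patchE mem_xsection.
    - by apply: measurable_funTS; exact/measurable_EFinP.
    - by move=> r _; rewrite lee_fin.
    - by rewrite lee_fin.
  apply/esym; apply: integral0_eq => r _.
  by rewrite /f patchE memNset// => -[/mem_set].
rewrite Fub [RHS]integral_mkcond; apply: eq_integral => r _.
rewrite patchE; case: ifPn => [|/negP r0]; last first.
  apply: integral0_eq => x _; rewrite /f patchE memNset// => -[_ /= r0' _].
  by apply: r0; rewrite mem_setE in_itv/= r0'.
rewrite mem_setE in_itv/= andbT => r0.
have -> : [set x | D x /\ (r%:E < g x)%E] = ysection E r.
  by apply/seteqP; split => x; rewrite /ysection/= inE => -[]//; split.
have my := measurable_ysection r mE.
rewrite -ge0_integralZl//.
- rewrite [RHS]integral_mkcond; apply: eq_integral => x _.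
  by rewrite /f !patchE mem_ysection [in RHS]muleC.
- by apply: measurable_funTS; exact/measurable_EFinP.
- by move=> x _; rewrite lee_fin.
- by rewrite lee_fin.
Qed.

(* For [v = 1] and [g] with values in R this is Cavalieri's principle. *)
Lemma integral_powR_superlevel_weight (D : set T) (g v : T -> R) (al : R) : 1 <= al ->
  (forall x, D x -> 0 <= g x) ->
  (forall x, 0 <= v x) -> measurable_fun setT v ->
  measurable [set p : T * measurableTypeR R | [/\ D p.1, 0 < p.2 & p.2 < g p.1]] ->
  (\int[mu]_(x in D) (v x * g x `^ al)%:E =
   \int[lebesgue_measure]_(r in `]0%R, +oo[) ((al * r `^ (al - 1))%:E *
     \int[mu]_(x in [set x | D x /\ (r < g x)%R]) (v x)%:E))%E.
Proof.
move=> al1 g0 v0 mv mE.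
have := @integral_superlevel D (EFin \o g) v (fun r => al * r `^ (al - 1)) v0 mv.
rewrite [X in measurable X -> _](_ : _ = [set p | [/\ D p.1, 0 < p.2 & p.2 < g p.1]]); last first.
  by apply/seteqP; split => p /= -[]; rewrite lte_fin.
move=> /(_ _ _ mE) I.
rewrite -I.
- apply: eq_integral => x /set_mem Dx /=.
  rewrite EFinM -(integral_powR_layer al1 (g0 x Dx)).
  congr (_ * integral _ _ _)%E; apply/seteqP; split => r /=; rewrite in_itv/= lte_fin;
    [by move=> /andP[]|by move=> [-> ->]].
- by move=> r; rewrite mulr_ge0 ?powR_ge0// (le_trans _ al1).
- by apply: measurable_funM => //; exact: measurable_powR.
Qed.

Lemma integral_powR_superlevel (D : set T) (g : T -> R) (al : R) : 1 <= al ->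
  measurable D ->
  (forall x, D x -> 0 <= g x) ->
  measurable [set p : T * measurableTypeR R | [/\ D p.1, 0 < p.2 & p.2 < g p.1]] ->
  (\int[mu]_(x in D) (g x `^ al)%:E =
   \int[lebesgue_measure]_(r in `]0%R, +oo[)
     ((al * r `^ (al - 1))%:E * mu [set x | D x /\ (r < g x)%R]))%E.
Proof.
move=> al1 mD g0 mE.
transitivity (\int[mu]_(x in D) (cst 1 x * g x `^ al)%:E)%E.
  by apply: eq_integral => x _; rewrite mul1r.
rewrite integral_powR_superlevel_weight//; apply: eq_integral => r.
rewrite inE/= in_itv/= andbT => r0; rewrite integral_cst ?mul1e//.
have := measurable_ysection (r : measurableTypeR R) mE; congr measurable.
by apply/seteqP; split => x; rewrite /ysection/= inE => -[]//; split.
Qed.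

Lemma integral_superlevel1 (D : set T) (g : T -> \bar R) :
  (forall x, D x -> 0 <= g x)%E ->
  measurable [set p : T * measurableTypeR R | [/\ D p.1, 0 < p.2 & (p.2%:E < g p.1)%E]] ->
  (\int[mu]_(x in D) g x =
   \int[lebesgue_measure]_(r in `]0%R, +oo[) mu [set x | D x /\ (r%:E < g x)%E])%E.
Proof.
move=> g0 mE.
have I := @integral_superlevel D g (cst 1) (cst 1).
transitivity (\int[mu]_(x in D)
    \int[lebesgue_measure]_(r in [set r | (0 < r)%R /\ (r%:E < g x)%E]) 1)%E; last first.
  transitivity (\int[mu]_(x in D) (1 * \int[lebesgue_measure]_(r in
      [set r | (0 < r)%R /\ (r%:E < g x)%E]) 1))%E.
    by apply: eq_integral => x _; rewrite mul1e.
  rewrite I//; apply: eq_integral => r; rewrite inE/= in_itv/= andbT => r0.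
  rewrite mul1e integral_cst ?mul1e//.
  have := measurable_ysection (r : measurableTypeR R) mE; congr measurable.
  by apply/seteqP; split => x; rewrite /ysection/= inE => -[]//; split.
apply: eq_integral => x /set_mem Dx.
have := g0 x Dx; case: (g x) => [y y0|_|//].
- rewrite (_ : [set r | _] = `]0, y[%classic); last first.
    apply/seteqP; split => r /=; rewrite in_itv/= lte_fin;
      [by move=> [-> ->]|by move=> /andP[]].
  rewrite integral_cst// mul1e [RHS]lebesgue_measure_itv/= lte_fin sube0.
  by case: ltP => // y0'; congr EFin; apply: le_anti; rewrite y0' -lee_fin y0.
- rewrite (_ : [set r | _] = `]0, +oo[%classic); last first.
    by apply/seteqP; split => r /=; rewrite in_itv/= andbT ltry; [case|].
  by rewrite integral_cst// mul1e [RHS]lebesgue_measure_itv/= ltry.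
Qed.

End layer_cake.

(** This is (b - a)(y - x) >= 0, expanded so that no difference of possibly infinite quantities
    occurs. *)
Lemma rearrangement_ereal (R : realType) (a b : R) (x y : \bar R) :
  0 <= a <= b -> (0 <= x <= y)%E ->
  (a%:E * y + b%:E * x <= a%:E * x + b%:E * y)%E.
Proof.
move=> /andP[a0 ab] /andP[x0 xy]; have y0 := le_trans x0 xy.
have d0 : 0 <= b - a by rewrite subr_ge0.
rewrite -(subrKC a b) EFinD !ge0_muleDl ?lee_fin// addeCA leeD2l//.
by rewrite leeD2l// lee_wpmul2l// lee_fin.
Qed.

(* The crossing argument: [phi - e <= 0] right of [r0] and [psi - e >= 0] left
   of it, so that replacing the weight [r^(al-1)] by [r0^(al-1)] increases
   [phi - e] up to [psi - e]. *)
Lemma crossing_integral (R : realType) (al r0 : R) (phi psi e : R -> \bar R) :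
  1 <= al -> 0 <= r0 ->
  (forall r, 0 <= phi r)%E -> (forall r, 0 <= psi r)%E -> (forall r, 0 <= e r)%E ->
  measurable_fun (`]0, +oo[%classic : set R) phi -> measurable_fun (`]0, +oo[%classic : set R) psi ->
  measurable_fun (`]0, +oo[%classic : set R) e ->
  (forall r, (0 < r)%R -> phi r <= psi r)%E ->
  (forall r, (0 < r < r0)%R -> e r <= psi r)%E ->
  (forall r, (r0 < r)%R -> phi r <= e r)%E ->
  (\int[lebesgue_measure]_(r in `]0%R, +oo[) psi r <=
   \int[lebesgue_measure]_(r in `]0%R, +oo[) e r)%E ->
  (\int[lebesgue_measure]_(r in `]0%R, +oo[) e r < +oo)%E ->
  (\int[lebesgue_measure]_(r in `]0%R, +oo[) ((al * r `^ (al - 1))%R%:E * phi r) <=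
   \int[lebesgue_measure]_(r in `]0%R, +oo[) ((al * r `^ (al - 1))%R%:E * e r))%E.
Proof.
move=> al1 r00 phi0 psi0 e0 mphi mpsi me phipsi epsi phie psie eoo.
have al0 : 0 <= al by exact: le_trans al1.
pose W r := al * r `^ (al - 1).
have W0 r : 0 <= W r by rewrite mulr_ge0 ?powR_ge0.
have W0E r : (0 <= (W r)%:E)%E by rewrite lee_fin.
have Wle r s : 0 <= r -> r <= s -> W r <= W s.
  move=> r_ge0 rs; have s_ge0 := le_trans r_ge0 rs.
  by rewrite ler_wpM2l// ge0_ler_powR ?nnegrE ?subr_ge0.
have mWT : measurable_fun [set: R] W.
  by apply: measurable_funM => //; exact: measurable_powR.
have mW (D : set R) : measurable_fun D (EFin \o W).
  by apply: measurable_funTS; exact/measurable_EFinP.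
have mI (u : R -> \bar R) : measurable_fun (`]0, +oo[%classic : set R) u ->
    measurable_fun (`]0, +oo[%classic : set R) (fun r => (W r)%:E * u r)%E.
  by move=> mu; apply: emeasurable_funM => //; exact: mW.
have mC (k : R) (u : R -> \bar R) : measurable_fun (`]0, +oo[%classic : set R) u ->
    measurable_fun (`]0, +oo[%classic : set R) (fun r => k%:E * u r)%E.
  by move=> mu; exact: measurable_funeM.
set P := (X in (X <= _)%E); set E := (X in (_ <= X)%E).
set D : set R := `]0%R, +oo[%classic.
have mD : measurable D by exact: measurable_itv.
(* Integrated form of W(r) (phi - e) <= W(r0) (psi - e), with the subtracted terms moved to the
   other side. Only the integral of e, which is finite, is cancelled at the end. *)
have : (\int[lebesgue_measure]_(r in D) ((W r)%:E * phi r + (W r0)%:E * e r) <=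
        \int[lebesgue_measure]_(r in D) ((W r)%:E * e r + (W r0)%:E * psi r))%E.
  apply: ge0_le_integral => //.
  - by move=> r _; rewrite adde_ge0// mule_ge0.
  - by apply: emeasurable_funD; [exact: mI|exact: mC].
  - by apply: emeasurable_funD; [exact: mI|exact: mC].
  move=> r; rewrite /D/= in_itv/= andbT => r_gt0.
  have [rr0|r0r|<-] := ltgtP r r0.
  - apply: (@le_trans _ _ ((W r)%:E * psi r + (W r0)%:E * e r)%E).
      by rewrite leeD2r// lee_wpmul2l// phipsi.
    apply: rearrangement_ereal; first by rewrite W0 Wle// ltW.
    by rewrite e0 epsi// r_gt0.
  - apply: (@le_trans _ _ ((W r)%:E * e r + (W r0)%:E * phi r)%E).
      rewrite [leLHS]addeC [leRHS]addeC; apply: rearrangement_ereal.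
        by rewrite W0 Wle// ltW.
      by rewrite phi0 phie.
    by rewrite leeD2l// lee_wpmul2l// phipsi.
  - by rewrite addeC leeD2l// lee_wpmul2l// phipsi.
rewrite !ge0_integralD//; first last.
- exact: mC.
- by move=> r _; rewrite mule_ge0.
- exact: mI.
- by move=> r _; rewrite mule_ge0.
- exact: mC.
- by move=> r _; rewrite mule_ge0.
- exact: mI.
- by move=> r _; rewrite mule_ge0.
rewrite !ge0_integralZl_EFin// => h.
have Wefin : ((W r0)%:E * \int[lebesgue_measure]_(r in D) e r)%E \is a fin_num.
  by rewrite fin_numM// ge0_fin_numE//; exact: integral_ge0.
rewrite -(leeD2rE _ _ Wefin); apply: (le_trans h).
by rewrite leeD2l// lee_wpmul2l.
Qed.

Lemma measurable_subgraph d (T : measurableType d) (R : realType) (D : set T)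
    (g : T -> R) : measurable D -> measurable_fun setT g ->
  measurable [set p : T * measurableTypeR R | [/\ D p.1, 0 < p.2 & p.2 < g p.1]].
Proof.
move=> mD mg.
have -> : [set p : T * measurableTypeR R | [/\ D p.1, 0 < p.2 & p.2 < g p.1]] =
    (D `*` `]0%R, +oo[%classic) `&`
    ((fun p : T * measurableTypeR R => p.2 < g p.1) @^-1` [set true]).
  apply/seteqP; split => p /=; rewrite in_itv/= andbT.
    by move=> [].
  by move=> [[]].
apply: measurableI; first exact: measurableX.
have : measurable_fun setT (fun p : T * measurableTypeR R => p.2 < g p.1).
  by apply: measurable_fun_ltr => //; exact: measurableT_comp.
by move=> /(_ measurableT [set true]); rewrite setTI; exact.
Qed.

(** * The Gamma integral and the moments of the exponential profile *)

Section gamma.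
Context {R : realType}.
Local Notation mu := lebesgue_measure.

Lemma expdtE (A : set (measurableTypeR R)) : measurable A -> A `<=` `[0, +oo[ ->
  expdt R A = (\int[mu]_(t in A) (expR (- t))%:E)%E.
Proof.
move=> mA A0; rewrite /expdt/= /exponential_prob; apply: eq_integral => t /set_mem/A0.
by rewrite /= in_itv/= andbT => t0; rewrite exponential_pdfE// mul1r mulN1r.
Qed.

Lemma Gamma_lty (q : R) : 0 < q -> (Gamma (1 + q) < +oo)%E.
Proof.
move=> q0; rewrite /Gamma.
have bound (t : R) : 0 < t ->
    t `^ (1 + q - 1) * expR (- t) <= (2 * q) `^ q * 2 * exponential_pdf 2^-1 t.
  move=> t0; rewrite addrAC subrr add0r (exponential_pdfE _ (ltW t0)) mulrA -(mulrA _ 2).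
  rewrite divff ?mulr1//.
  have q20 : 0 < 2 * q by rewrite mulr_gt0.
  (* From u <= exp(u) at u = t / (2 q). Its q-th power costs exp(t / 2), which leaves the integrable
     exp(- t / 2), twice the exponential density of rate 1/2. *)
  have te : t <= 2 * q * expR (t / (2 * q)).
    rewrite -ler_pdivrMl// (le_trans _ (expR_ge1Dx _))// mulrC lerDr ler01//.
  have h : t `^ q <= (2 * q) `^ q * expR (t / (2 * q)) `^ q.
    rewrite -powRM ?expR_ge0 ?(ltW q20)//; apply: ge0_ler_powR => //.
    - exact: ltW.
    - by rewrite nnegrE ltW.
    - by rewrite nnegrE mulr_ge0 ?expR_ge0 ?(ltW q20).
  have -> : expR (- 2^-1 * t) = expR (t / (2 * q)) `^ q * expR (- t).
    rewrite -expRM -expRD; congr expR; field; rewrite gt_eqF//.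
  by rewrite mulrA ler_pM2r ?expR_gt0.
have mpdf := @measurable_exponential_pdf R 2^-1.
apply: (@le_lt_trans _ _ (\int[mu]_(t in `]0%R, +oo[)
    (((2 * q) `^ q * 2)%:E * (exponential_pdf 2^-1 t)%:E))%E).
  apply: ge0_le_integral => //.
  - by move=> t _; rewrite lee_fin mulr_ge0 ?powR_ge0 ?expR_ge0.
  - apply: measurable_funTS; apply/measurable_EFinP; apply: measurable_funM.
      exact: measurable_powR.
    by apply: measurableT_comp => //; exact: measurableT_comp.
  - apply: measurable_funTS; apply/measurable_EFinP; exact: measurable_funM.
  - by move=> t; rewrite /= in_itv/= andbT -EFinM lee_fin => /bound.
rewrite ge0_integralZl_EFin//; last first.
- by rewrite mulr_ge0 ?powR_ge0.
- by apply: measurable_funTS; apply/measurable_EFinP.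
- by move=> t _; rewrite lee_fin exponential_pdf_ge0.
apply: lte_mul_pinfty => //; first by rewrite lee_fin mulr_ge0 ?powR_ge0.
apply: (@le_lt_trans _ _ 1%E); last exact: ltry.
rewrite -(@integral_exponential_pdf R 2^-1)//.
apply: ge0_subset_integral => //.
- by apply/measurable_EFinP.
- by move=> t _; rewrite lee_fin exponential_pdf_ge0.
Qed.

Lemma Gamma_gt0 (q : R) : 0 < q -> (0 < Gamma (1 + q))%E.
Proof.
move=> q0; rewrite /Gamma.
apply: (@lt_le_trans _ _ (\int[mu]_(t in `]1%R, +oo[) (expR (- t))%:E)%E).
  suff <- : expdt R (`]1%R, +oo[%classic : set R) =
      (\int[mu]_(t in `]1%R, +oo[) (expR (- t))%:E)%E.
    by rewrite expdt_itvoy// lte_fin expR_gt0.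
  apply: expdtE => // t /=; rewrite !in_itv/= !andbT => /ltW; exact: le_trans.
apply: (@le_trans _ _ (\int[mu]_(t in `]1%R, +oo[) (t `^ (1 + q - 1) * expR (- t))%R%:E)%E).
  apply: ge0_le_integral => //.
  - by apply: measurable_funTS; apply/measurable_EFinP; apply: measurableT_comp => //; exact: measurableT_comp.
  - apply: measurable_funTS; apply/measurable_EFinP; apply: measurable_funM.
      exact: measurable_powR.
    by apply: measurableT_comp => //; exact: measurableT_comp.
  - move=> t; rewrite /= in_itv/= andbT => t1; rewrite lee_fin ler_peMl ?expR_ge0//.
    rewrite addrAC subrr add0r -(powRr0 t); apply: ler_powR; last exact: ltW.
    exact: ltW.
apply: ge0_subset_integral => //.
- apply: measurable_funTS; apply/measurable_EFinP; apply: measurable_funM.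
    exact: measurable_powR.
  by apply: measurableT_comp => //; exact: measurableT_comp.
- by move=> t _; rewrite lee_fin mulr_ge0 ?powR_ge0 ?expR_ge0.
- by move=> t /=; rewrite !in_itv/= !andbT; exact: lt_trans.
Qed.

(** A layer cake formula read backwards replaces the change of variables: exp(- c r^(1/p)) is the
    [expdt]-mass of the s > 0 with r < (s / c)^p, so the left-hand side is the integral of (s /
    c)^(p al) exp(- s). *)
Lemma integral_powR_expR (p al c : R) : 0 < p -> 1 <= al -> 0 < c ->
  (\int[mu]_(r in `]0%R, +oo[)
     ((al * r `^ (al - 1))%R%:E * (expR (- (c * r `^ p^-1)))%R%:E) =
   (c `^ (- (p * al)))%R%:E * Gamma (1 + p * al))%E.
Proof.
move=> p0 al1 c0.
have pal0 : 0 < p * al by rewrite mulr_gt0// (lt_le_trans _ al1).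
have mexp D : measurable_fun D (fun t : R => expR (- t)).
  by apply: measurable_funTS; apply: measurableT_comp => //; exact: measurableT_comp.
have mg : measurable_fun setT (fun t : R => (c^-1 * t) `^ p).
  apply: (measurableT_comp (measurable_powR _)); exact: measurable_funM.
have ltE r s : 0 < r -> 0 < s -> (r < (c^-1 * s) `^ p) = (c * r `^ p^-1 < s).
  move=> r0 s0; have cs0 : 0 <= c^-1 * s by rewrite mulr_ge0 ?invr_ge0 ?ltW.
  rewrite -[RHS](ltr_pM2l (_ : 0 < c^-1)) ?invr_gt0// mulKf ?gt_eqF//.
  apply/idP/idP => [|] h.
    rewrite -[ltRHS](powRr1 cs0) -(divff (lt0r_neq0 p0)) powRrM.
    by rewrite gt0_ltr_powR ?nnegrE ?invr_gt0 ?powR_ge0// ltW.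
  rewrite -[ltLHS](powRr1 (ltW r0)) -(mulVf (lt0r_neq0 p0)) powRrM.
  by rewrite gt0_ltr_powR ?nnegrE ?powR_ge0.
have mE : measurable [set q : measurableTypeR R * measurableTypeR R |
    [/\ `]0%R, +oo[%classic q.1, 0 < q.2 & q.2 < (c^-1 * q.1) `^ p]].
  apply: (@measurable_subgraph _ (measurableTypeR R) R `]0%R, +oo[%classic
    (fun s => (c^-1 * s) `^ p)).
    exact: measurable_itv.
  exact: mg.
have := @integral_powR_superlevel_weight _ (measurableTypeR R) R (@lebesgue_measure R)
  `]0%R, +oo[%classic (fun s => (c^-1 * s) `^ p) (fun s => expR (- s)) al al1.
move=> /(_ _ _ _ mE) I.
transitivity (\int[mu]_(r in `]0%R, +oo[) ((al * r `^ (al - 1))%R%:E *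
    \int[mu]_(x in [set x | (`]0%R, +oo[%classic x) /\ (r < (c^-1 * x) `^ p)%R]) (expR (- x))%:E))%E.
  apply: eq_integral => r; rewrite inE/= in_itv/= andbT => r0; congr (_ * _)%E.
  have cr0 : 0 <= c * r `^ p^-1 by rewrite mulr_ge0 ?powR_ge0// ltW.
  rewrite -expdt_itvoy// (@expdtE `]c * r `^ p^-1, +oo[%classic)//; last first.
    by move=> t; rewrite /= !in_itv/= !andbT => /ltW; exact: le_trans.
  congr integral; apply/seteqP; split => s /=; rewrite !in_itv/= !andbT.
    move=> crs; have s0 := le_lt_trans cr0 crs.
    by rewrite s0 ltE.
  by move=> [s0]; rewrite ltE.
rewrite -I//; last 2 first.
- by move=> s _; exact: powR_ge0.
- exact: mexp.
rewrite /Gamma -ge0_integralZl_EFin//.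
- apply: eq_integral => s; rewrite inE/= in_itv/= andbT => s0; rewrite -EFinM; congr EFin.
  rewrite (addrC 1) addrK -powRrM powRM ?invr_ge0 ?(ltW c0) ?(ltW s0)//.
  by rewrite -(powR_inv1 (ltW c0)) -powRrM mulN1r [LHS]mulrC -mulrA.
- by move=> s _; rewrite lee_fin mulr_ge0 ?powR_ge0 ?expR_ge0.
- apply: measurable_funTS; apply/measurable_EFinP; apply: measurable_funM.
    exact: measurable_powR.
  exact: mexp.
- by rewrite powR_ge0.
Qed.

End gamma.

(** * Measurability of subgraphs and of upward closed sets *)

Lemma measurable_superlevel d (T : measurableType d) (R : realType) (D : set T)
    (g : T -> \bar R) :
  (forall r : R, 0 < r -> measurable [set x | D x /\ (r%:E < g x)%E]) ->
  measurable [set p : T * measurableTypeR R | [/\ D p.1, 0 < p.2 & (p.2%:E < g p.1)%E]].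
Proof.
move=> mg.
(* A rational between r and g x witnesses r < g x, so the subgraph is a countable union of
   rectangles. *)
have -> : [set p : T * measurableTypeR R | [/\ D p.1, 0 < p.2 & (p.2%:E < g p.1)%E]] =
    \bigcup_(q : rat) (if (0 < q)%R then
       [set x | D x /\ ((ratr q : R)%:E < g x)%E] `*` (`]0%R, ratr q[%classic : set (measurableTypeR R))
     else set0).
  apply/seteqP; split => [[x r] [/= Dx r0 rg]|[x r] [q _]]; last first.
    case: ifPn => // q0 -[/= [Dx qg]]; rewrite in_itv/= => /andP[r0 rq].
    by split => //; apply: lt_trans qg; rewrite lte_fin.
  have [q rq qg] : exists2 q : rat, r < ratr q & ((ratr q : R)%:E < g x)%E.
    case: (g x) rg => [y||//].
      rewrite lte_fin => /rat_in_itvoo[q]; rewrite in_itv/= => /andP[rq qy].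
      by exists q.
    have /rat_in_itvoo[q] : r < r + 1 by rewrite ltrDl.
    by rewrite in_itv/= => /andP[rq _] _; exists q => //; rewrite ltry.
  exists q => //; have q0 : 0 < q by rewrite -(ltr0q R) (lt_trans r0).
  by rewrite q0; split => //=; rewrite in_itv/= r0.
apply: bigcupT_measurable_rat => q; case: ifPn => // q0.
by apply: measurableX => //; apply: mg; rewrite ltr0q.
Qed.

Section up_closed.
Context {R : realType} {n : nat}.
Implicit Types (A : set ('rV[R]_n * R)) (x y z : 'rV[R]_n) (t u : R).

Definition up_closed A := (forall x t, A (x, t) -> 0 <= t) /\
  forall x t u, A (x, t) -> t <= u -> A (x, u).

(** Each vertical fiber is empty or a half-line, closed or open, starting at [tau x]. Since all sets
    of base points are measurable, so are [tau], [X1] (closed fibers) and [X2] (open fibers),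
    however irregular A is. *)
Lemma measurable_up_closed A : up_closed A ->
  measurable (A : set (discreteRn R n * measurableTypeR R)).
Proof.
move=> [A0 Aup].
(* On an empty fiber [inf] defaults to 0; such x belong to neither [X1] nor [X2]. *)
pose tau (x : discreteRn R n) : R := inf [set t | A (x, t)].
have lbA x t : A (x, t) -> tau x <= t.
  by move=> Axt; apply: ge_inf => //; exists 0 => u /= /A0.
have infA x t u : A (x, t) -> tau x < u -> exists2 v, A (x, v) & v < u.
  by move=> Axt; apply: inf_lt; exists t.
pose X1 := [set x : discreteRn R n | A (x, tau x)].
pose X2 := [set x : discreteRn R n | (exists t, A (x, t)) /\ ~ A (x, tau x)].
have mtau : measurable_fun setT
    (fun p : discreteRn R n * measurableTypeR R => tau p.1 : measurableTypeR R).
  have mt : measurable_fun setT (tau : discreteRn R n -> measurableTypeR R).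
    by move=> _ Y _.
  exact: (measurableT_comp mt measurable_fst).
have msnd : measurable_fun setT
  (fun p : discreteRn R n * measurableTypeR R => p.2 : measurableTypeR R).
  exact: measurable_snd.
have -> : A = ((X1 `*` setT) `&` (fun p => tau p.1 <= p.2) @^-1` [set true]) `|`
    ((X2 `*` setT) `&` (fun p => tau p.1 < p.2) @^-1` [set true]).
  apply/seteqP; split => [[x t] Axt|[x t] [[[/= X1x _] /= tx]|[[/= [[u Axu] X2x] _] /= tx]]].
  - have [X1x|X2x] := pselect (A (x, tau x)).
      by left; split => //=; rewrite lbA.
    right; split; first by split => //=; split => //; exists t.
    rewrite /= lt_neqAle lbA// andbT; apply/negP => /eqP txt.
    by apply: X2x; rewrite txt.
  - exact: Aup tx.
  - have [v Axv vt] := infA _ _ _ Axu tx.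
    exact: Aup Axv (ltW vt).
apply: measurableU; apply: measurableI; try exact: measurableX.
- have : measurable_fun setT (fun p : discreteRn R n * measurableTypeR R => tau p.1 <= p.2).
    exact: measurable_fun_ler.
  by move=> /(_ measurableT [set true]); rewrite setTI; exact.
- have : measurable_fun setT (fun p : discreteRn R n * measurableTypeR R => tau p.1 < p.2).
    exact: measurable_fun_ltr.
  by move=> /(_ measurableT [set true]); rewrite setTI; exact.
Qed.

Lemma expdt_xsection_ge A x t : up_closed A -> A (x, t) ->
  ((expR (- t))%:E <= expdt R (xsection (A : set (discreteRn R n * measurableTypeR R)) x))%E.
Proof.
move=> Aup Axt; have [A0 up] := Aup; rewrite -expdt_itvcy; last exact: A0 Axt.
apply: le_measure; rewrite ?inE//.
- by apply: measurable_xsection; exact: measurable_up_closed.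
- move=> u /=; rewrite in_itv/= andbT => tu; rewrite /xsection/= inE.
  exact: up Axt tu.
Qed.

(** Turns the mass of a fiber into an actual point, to which convexity can be applied. The
    inequality with a must be strict, because the half-line may be open and its endpoint not
    attained. *)
Lemma expdt_xsection_gt A x (a : R) : up_closed A -> 0 < a ->
  (a%:E < expdt R (xsection (A : set (discreteRn R n * measurableTypeR R)) x))%E ->
  exists2 t, A (x, t) & a <= expR (- t).
Proof.
move=> Aup a0 aA; have [A0 up] := Aup.
apply: contrapT => /forall2NP H.
have Alt t : A (x, t) -> - ln a < t.
  move=> Axt; have [//|/negP] := H t; rewrite -ltNge => ta.
  by rewrite ltrNl -(expRK (- t)) ltr_ln ?posrE ?expR_gt0.
have mx : measurable (xsection (A : set (discreteRn R n * measurableTypeR R)) x).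
  by apply: measurable_xsection; exact: measurable_up_closed.
have : (expdt R (xsection (A : set (discreteRn R n * measurableTypeR R)) x) <= a%:E)%E.
  have [a1|a1] := leP 1 a; first by rewrite (le_trans (probability_le1 _ mx)) ?lee_fin.
  have la : 0 <= - ln a by rewrite oppr_ge0 ln_le0// ltW.
  rewrite -[a in leRHS]lnK ?posrE// -[ln a]opprK -expdt_itvoy//.
  apply: le_measure; rewrite ?inE//.
  by move=> u /=; rewrite in_itv/= andbT /xsection/= inE => /Alt.
by rewrite leNgt aA.
Qed.

End up_closed.

(** * Superlevel sets of h and of its Asplund product *)

(** Closes the strict inequality on the first argument: using a (1 - e) instead of a costs the
    factor (1 - e)^(1-l) >= 1 - e, and e is arbitrarily small. *)
Lemma geometric_mean_le_fin (R : realType) (l a b : R) (v w : \bar R) :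
  0 < l < 1 -> 0 < a -> 0 < b -> (b%:E < v)%E ->
  geometric_mean_le l a%:E v w -> ((a `^ (1 - l) * b `^ l)%:E <= w)%E.
Proof.
move=> /andP[l0 l1] a0 b0 bv gm; set m := a `^ (1 - l) * b `^ l.
have m0 : 0 < m by rewrite mulr_gt0 ?powR_gt0.
have H (e : R) : 0 < e < 1 -> ((m * (1 - e))%:E <= w)%E.
  move=> /andP[e0 e1]; have e1' : 0 < 1 - e by rewrite subr_gt0.
  apply: (@le_trans _ _ (((a * (1 - e)) `^ (1 - l) * b `^ l)%:E)).
    rewrite lee_fin powRM ?(ltW a0) ?(ltW e1')// [leRHS]mulrAC -/m ler_pM2l//.
    by apply: ger1_powR; [rewrite e1'/= gerBl ltW|rewrite gerBl ltW].
  apply: gm => //; first by rewrite mulr_gt0.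
  by rewrite lte_fin gtr_pMr// gtrBl.
case: w gm H => [w|_ _|_ H]; last 2 first.
- exact: leey.
- by have := H 2^-1; rewrite invr_gt0 ltr0n invf_lt1// ltr1n => /(_ isT).
move=> _ H; rewrite lee_fin leNgt; apply/negP => wm.
(* This lower bound makes e = (m - w) / (2 m) smaller than 1; that e gives (m + w) / 2 <= w, against
   w < m. *)
have w2 : m * (1 - 2^-1) <= w.
  by rewrite -lee_fin H// invr_gt0 ltr0n invf_lt1// ltr1n.
have m20 : 0 < 2 * m by rewrite mulr_gt0.
have := H ((m - w) / (2 * m)); rewrite divr_gt0 ?subr_gt0//= ltr_pdivrMr// mul1r.
have -> : m * (1 - (m - w) / (2 * m)) = (m + w) / 2 by field; rewrite gt_eqF.
rewrite lee_fin => /(_ _)K.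
have : (m + w) / 2 <= w by apply: K; lra.
lra.
Qed.

Section berwald.
Context {R : realType} {n : nat} (f : 'rV[R]_n -> R) (h : 'rV[R]_n * R -> R).
Hypothesis f_log_concave : log_concave f.
Hypothesis f_max : supnorm f = (f 0)%:E.
Hypothesis h_ge0 : forall z, Lset f z -> 0 <= h z.
Hypothesis h_concave : concave_on (Lset f) h.

Local Notation L := (Lset f).
Local Notation C := (@cubeC R n).
Local Notation LC := (minkowski_sum L C).
Local Notation hC := (asplund (patch (cst 0%R) L h) \1_C).

Lemma log_concave_ge0 x : 0 <= f x.
Proof. by have [u [_ _ fE]] := f_log_concave; rewrite -lee_fin fE expeR_ge0. Qed.

Lemma LsetE x t : L (x, t) <-> 0 <= t /\ expR (- t) * f 0 <= f x.
Proof. by rewrite /Lset/= f_max -EFinM lee_fin. Qed.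

Lemma Lset_up : up_closed L.
Proof.
split => [x t /LsetE[]//|x t u /LsetE[t0 ft] tu].
apply/LsetE; split; first exact: le_trans tu.
apply: le_trans ft; rewrite ler_wpM2r ?log_concave_ge0//.
by rewrite ler_expR lerN2.
Qed.

Lemma Lset_axis t : 0 <= t -> L (0, t).
Proof.
move=> t0; apply/LsetE; split => //; rewrite ler_piMl ?log_concave_ge0//.
by rewrite -expR0 ler_expR oppr_le0.
Qed.

(** Writing f = exp(- U), for f(0) > 0 the set L is the part t >= 0 of the epigraph of the convex
    function U + ln f(0). For f(0) = 0 the condition on f in L is void. *)
Lemma Lset_convex l x y t u : 0 < l < 1 -> L (x, t) -> L (y, u) ->
  L ((1 - l) *: x + l *: y, (1 - l) * t + l * u).
Proof.
move=> /andP[l0 l1] /LsetE[t0 fx] /LsetE[u0 fy]; apply/LsetE.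
have l'0 : 0 < 1 - l by rewrite subr_gt0.
split; first by rewrite addr_ge0 ?mulr_ge0// ltW.
have [U [UN Uconv fE]] := f_log_concave.
have := log_concave_ge0 0; rewrite le_eqVlt => /predU1P[<-|f0].
  by rewrite mulr0 log_concave_ge0.
have Ule z s : expR (- s) * f 0 <= f z ->
    exists2 v, U z = v%:E & v <= s - ln (f 0).
  move=> fz; have := fE z; have := UN z; case: (U z) => [v _| _|//]; last first.
    move=> [fz0]; move: fz; rewrite fz0.
    by rewrite leNgt mulr_gt0 ?expR_gt0.
  rewrite -EFinN /= => -[fzE]; exists v => //; move: fz; rewrite fzE.
  rewrite -{1}(lnK (_ : f 0 \is Num.pos)) ?posrE// -expRD ler_expR; lra.
have [a Ux ax] := Ule _ _ fx; have [b Uy bx] := Ule _ _ fy.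
have := Uconv x y (1 - l); rewrite subr_ge0 (ltW l1) gerBl (ltW l0) => /(_ isT).
rewrite subKr Ux Uy -!EFinM -EFinD => Uw.
rewrite -lee_fin fE; set w := (_ *: _ + _) in Uw *.
rewrite -{1}(lnK (_ : f 0 \is Num.pos)) ?posrE// -expRD.
case: (U w) (UN w) Uw => [v _|_|//]; last by rewrite leye_eq.
rewrite lee_fin -EFinN /= lee_fin ler_expR => vab.
have : (1 - l) * a <= (1 - l) * (t - ln (f 0)) by rewrite ler_wpM2l// ltW.
have : l * b <= l * (u - ln (f 0)) by rewrite ler_wpM2l// ltW.
lra.
Qed.

Lemma concave_on_le l x y t u : 0 < l < 1 -> L (x, t) -> L (y, u) ->
  (1 - l) * h (x, t) + l * h (y, u) <=
  h ((1 - l) *: x + l *: y, (1 - l) * t + l * u).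
Proof.
move=> /andP[l0 l1] Lx Ly.
have l'0 : 0 <= 1 - l by rewrite subr_ge0 ltW.
have l'1 : 1 - l <= 1 by rewrite gerBl ltW.
have := h_concave (Itv01 l'0 l'1) (mem_set Lx) (mem_set Ly).
have onemE : unstable.onem (1 - l) = l by exact: subKr.
rewrite convRE /= onemE !mulrN -opprD lerN2 => /le_trans; apply.
rewrite le_eqVlt; apply/orP; left; apply/eqP; congr h.
change ((1 - l) *: (x, t : R^o) + unstable.onem (1 - l) *: (y, u : R^o) =
  ((1 - l) *: x + l *: y, (1 - l) * t + l * u)).
by rewrite onemE.
Qed.

(* If [h] decreased somewhere on a half-line of [L], concavity would make it
   negative far out. *)
Lemma concave_on_nondecreasing x t u : L (x, t) -> t <= u -> h (x, t) <= h (x, u).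
Proof.
move=> Lt; rewrite le_eqVlt => /predU1P[->//|tu].
have [L0 Lup] := Lset_up; have Lu := Lup _ _ _ Lt (ltW tu).
rewrite leNgt; apply/negP => hut.
have hu0 := h_ge0 Lu.
have ht0 : 0 < h (x, t) by apply: le_lt_trans hut.
(* The point u divides [t, v] with weights 1 - l and l. As h >= 0 at v, concavity gives h(u) >= (1 -
   l) h(t), which for this l is the midpoint of h(t) and h(u), hence larger than h(u). *)
pose l := (h (x, t) - h (x, u)) / (2 * h (x, t)).
have l0 : 0 < l by rewrite divr_gt0 ?subr_gt0// mulr_gt0.
have l1 : l < 1 by rewrite ltr_pdivrMr ?mulr_gt0// mul1r; lra.
have l01 : 0 < l < 1 by rewrite l0.
pose v := t + (u - t) / l.
have tv : t <= v by rewrite lerDl divr_ge0 ?subr_ge0// ltW.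
have Lv := Lup _ _ _ Lt tv.
have := concave_on_le l01 Lt Lv.
rewrite -scalerDl subrK scale1r.
have -> : (1 - l) * t + l * v = u by rewrite /v; field; rewrite gt_eqF.
have : 0 <= l * h (x, v) by rewrite mulr_ge0 ?(ltW l0)// h_ge0.
have : l * h (x, t) = (h (x, t) - h (x, u)) / 2 by rewrite /l; field; rewrite gt_eqF.
lra.
Qed.

Definition superlevel s : set ('rV[R]_n * R) := [set z | L z /\ s < h z].

Lemma superlevel_up s : up_closed (superlevel s).
Proof.
have [L0 Lup] := Lset_up; split => [x t [/L0]//|x t u [Lt st] tu].
split; first exact: Lup Lt tu.
exact: lt_le_trans st (concave_on_nondecreasing Lt tu).
Qed.

Lemma asplund_ge z z' : L z' -> C (z - z') -> ((h z')%:E <= hC z)%E.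
Proof.
move=> Lz' Czz'; apply: ereal_sup_ubound; exists z' => //.
by rewrite patchE mem_set// indicE mem_set// mulr1.
Qed.

Lemma asplund_gt s z : 0 <= s -> (s%:E < hC z)%E ->
  exists z', [/\ L z', C (z - z') & s < h z'].
Proof.
move=> s0 /ereal_sup_gt[_ [z' _ <-]].
rewrite lte_fin patchE indicE; case: ifPn => [/set_mem Lz'|_]; last first.
  by rewrite mul0r ltNge s0.
have [/set_mem Czz'|_] := boolP (_ \in _); last by rewrite mulr0 ltNge s0.
by rewrite mulr1 => sh; exists z'.
Qed.

Lemma cubeC0 z : C (z - z).
Proof. by rewrite subrr; split => //= i; rewrite mxE ltrN10 ltr01. Qed.

Lemma asplund_ge0 z : (0 <= hC z)%E.
Proof.
apply: ereal_sup_ge; exists ((patch (cst 0) L h z * \1_C (z - z))%:E); first by exists z.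
rewrite lee_fin mulr_ge0//.
by rewrite patchE; case: ifPn => // /set_mem; exact: h_ge0.
Qed.

Definition asplund_superlevel s : set ('rV[R]_n * R) :=
  [set z | LC z /\ (s%:E < hC z)%E].

Lemma asplund_superlevelP s z z' : L z' -> C (z - z') -> s < h z' ->
  asplund_superlevel s z.
Proof.
move=> Lz' Czz' sh; split; last by apply: lt_le_trans (asplund_ge Lz' Czz').
by exists z' => //; exists (z - z') => //; rewrite addrC subrK.
Qed.

Lemma cubeC_shift x t z' u : C ((x, t) - z') -> 
  z'.2 = t /\ C ((x, u) - (z'.1, u)).
Proof.
case: z' => x' t' [/= Cx /eqP]; rewrite subr_eq0 => /eqP ->.
by split => //; split => //=; rewrite subrr.
Qed.

Lemma asplund_superlevel_up s : 0 <= s -> up_closed (asplund_superlevel s).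
Proof.
move=> s0; have [L0 Lup] := Lset_up; split => [x t [_ /(asplund_gt s0)]|x t u [_ /(asplund_gt s0)]].
  by move=> [[x' t'] [/L0 t'0 /(cubeC_shift t)[/= <-]]].
move=> [[x' t'] [Lt' /(cubeC_shift u)[/= t't Cu] sh]] tu.
move: t't Lt' sh => -> Lt' sh.
apply: asplund_superlevelP Cu _; first exact: Lup Lt' tu.
exact: lt_le_trans sh (concave_on_nondecreasing Lt' tu).
Qed.

Lemma superlevel_sub s : superlevel s `<=` asplund_superlevel s.
Proof. by move=> z [Lz sh]; apply: asplund_superlevelP sh => //; exact: cubeC0. Qed.

Lemma nu_up_le (A B : set ('rV[R]_n * R)) : up_closed A -> up_closed B -> A `<=` B ->
  (nu R n A <= nu R n B)%E.
Proof.
by move=> uA uB AB; apply: le_measure => //; rewrite inE; exact: measurable_up_closed.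
Qed.

(** Combining a point of L with one where h > s gives h > l s, since the contribution of the first
    point is nonnegative. Every lattice point near the combined base point differs from it by an
    element of the cube, so it inherits the bound at the same height. *)
Lemma nu_superlevel_geometric_mean l s : 0 < l < 1 -> 0 <= s ->
  (nu R n L < +oo)%E ->
  geometric_mean_le l (nu R n L) (nu R n (superlevel s))
    (nu R n (asplund_superlevel (l * s))).
Proof.
move=> l01 s0 Loo; have /andP[l0 l1] := l01.
have Hoo : (nu R n (superlevel s) < +oo)%E.
  apply: le_lt_trans Loo; apply: nu_up_le; [exact: superlevel_up|exact: Lset_up|].
  by move=> z [].
rewrite nuE in Loo; rewrite nuE in Hoo; rewrite !nuE.
apply: prekopa_leindler_Zn => // x y z _ _ _ near a b a0 b0.
move=> /(expdt_xsection_gt Lset_up a0)[t Lt at_].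
move=> /(expdt_xsection_gt (superlevel_up s) b0)[u [Lu su] bu].
have ls0 : 0 <= l * s by rewrite mulr_ge0// ltW.
have P : asplund_superlevel (l * s) (z, (1 - l) * t + l * u).
  apply: (asplund_superlevelP (Lset_convex l01 Lt Lu)).
    split => /=; last by rewrite subrr.
    by move=> i; rewrite !mxE -ltr_norml.
  apply: lt_le_trans (concave_on_le l01 Lt Lu).
  rewrite -[ltLHS]add0r ler_ltD ?mulr_ge0 ?subr_ge0 ?(ltW l1) ?h_ge0//.
  by rewrite ltr_pM2l.
apply: le_trans (expdt_xsection_ge (asplund_superlevel_up ls0) P).
rewrite lee_fin opprD -!mulrN expRD (mulrC (1 - l)) (mulrC l) !expRM.
apply: ler_pM; rewrite ?powR_ge0//.
- by rewrite ge0_ler_powR ?nnegrE ?subr_ge0 ?(ltW l1) ?(ltW a0) ?expR_ge0.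
- by rewrite ge0_ler_powR ?nnegrE ?(ltW l0) ?(ltW b0) ?expR_ge0.
Qed.

(** As f is maximal at 0, the fiber of L above this lattice point is [0, +oo[, of mass 1. So the
    normalization never divides by 0. *)
Lemma nu_Lset_ge1 : (1 <= nu R n L)%E.
Proof.
rewrite nuE; apply: (@le_trans _ _ (expdt R (xsection L 0))).
  have := expdt_xsection_ge Lset_up (Lset_axis (lexx 0)).
  by rewrite oppr0 expR0.
rewrite -(@esum_set1 R (discreteRn R n) 0 (fun x => expdt R (xsection L x)))//.
apply: esum_ge.
exists [set (0 : discreteRn R n)]; last by rewrite esum_set1// fsbig_set1.
split; first exact: finite_set1.
by move=> _ ->; move=> i; rewrite mxE rpred0.
Qed.

End berwald.

(** * Comparison of the superlevel profiles with an exponential *)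

Section berwald_comparison.
Context {R : realType} {n : nat} (f : 'rV[R]_n -> R) (h : 'rV[R]_n * R -> R).
Hypothesis f_log_concave : log_concave f.
Hypothesis f_max : supnorm f = (f 0)%:E.
Hypothesis h_ge0 : forall z, Lset f z -> 0 <= h z.
Hypothesis h_concave : concave_on (Lset f) h.

Local Notation mu := lebesgue_measure.
Local Notation L := (Lset f).
Local Notation C := (@cubeC R n).
Local Notation LC := (minkowski_sum L C).
Local Notation hC := (asplund (patch (cst 0%R) L h) \1_C).
Local Notation P := (asplund_superlevel f h).
Local Notation H := (superlevel f h).

Variables (a0 p q c : R).
Hypothesis nuL : nu R n L = a0%:E.
Hypotheses (p0 : 0 < p) (pq : p <= q) (c0 : 0 < c).

Let q0 : 0 < q. Proof. exact: lt_le_trans pq. Qed.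
(** In the variable r = s^p the moment of order p has weight 1 and that of order q has weight al
    r^(al-1). As al >= 1 this weight is nondecreasing, as the crossing argument requires, even if p
    < 1. *)
Let al : R := q / p.
Let al1 : 1 <= al. Proof. by rewrite ler_pdivlMr// mul1r. Qed.
Let pal : p * al = q. Proof. by rewrite mulrC divfK// gt_eqF. Qed.
Let a0_gt0 : 0 < a0.
Proof. by rewrite -lte_fin -nuL (lt_le_trans _ (nu_Lset_ge1 f_log_concave f_max)). Qed.

Let root (r : R) := r `^ p^-1.

Let root_lt r y : 0 < r -> 0 <= y -> (r < y `^ p) = (root r < y).
Proof.
move=> r0 y0; have p'0 : 0 < p^-1 by rewrite invr_gt0.
apply/idP/idP => ry.
  rewrite -[ltRHS](powRr1 y0) -(divff (lt0r_neq0 p0)) powRrM.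
  by rewrite gt0_ltr_powR ?nnegrE ?powR_ge0// ltW.
rewrite -[ltLHS](powRr1 (ltW r0)) -(mulVf (lt0r_neq0 p0)) powRrM.
by rewrite gt0_ltr_powR ?nnegrE ?powR_ge0.
Qed.

Let root_lte r (y : \bar R) : 0 < r -> (0 <= y)%E -> (r%:E < y `^ p)%E = ((root r)%:E < y)%E.
Proof.
move=> r0; case: y => [y|_|//]; first by rewrite lee_fin poweR_EFin !lte_fin => /(root_lt r0).
by rewrite poweRyr ?gt_eqF// !ltry.
Qed.

Let H_powR r : 0 < r -> [set z | L z /\ r < h z `^ p] = H (root r).
Proof.
move=> r0; apply/seteqP; split => z [Lz] rz; split => //; move: rz;
  by rewrite root_lt// h_ge0.
Qed.

Let P_poweR r : 0 < r -> [set z | LC z /\ (r%:E < hC z `^ p)%E] = P (root r).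
Proof.
move=> r0; apply/seteqP; split => z [Lz] rz; split => //; move: rz;
  by rewrite root_lte// asplund_ge0.
Qed.

Let phi r := nu_measure (n := n) [set z | L z /\ r < h z `^ p].
Let psi r := nu_measure (n := n) [set z | LC z /\ (r%:E < hC z `^ p)%E].
Let phiE r : 0 < r -> phi r = nu R n (H (root r)).
Proof. by move=> r0; exact: (congr1 (nu R n) (H_powR r0)). Qed.

Let psiE r : 0 < r -> psi r = nu R n (P (root r)).
Proof. by move=> r0; exact: (congr1 (nu R n) (P_poweR r0)). Qed.

Let e (r : R) : \bar R := (a0 * expR (- (c * r `^ p^-1)))%:E.

Let H_up s : up_closed (H s). Proof. exact: superlevel_up. Qed.
Let P_up s : 0 <= s -> up_closed (P s). Proof. by move=> s0; exact: asplund_superlevel_up. Qed.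

Let measurable_H : measurable [set x : (discreteRn R n * measurableTypeR R) * measurableTypeR R |
  [/\ L x.1, 0 < x.2 & (x.2%:E < (h x.1 `^ p)%:E)%E]].
Proof.
apply: (@measurable_superlevel _ (discreteRn R n * measurableTypeR R)%type R L (fun z => (h z `^ p)%:E)) => r r0.
have := measurable_up_closed (H_up (root r)); rewrite -H_powR//.
Qed.

Let measurable_P : measurable [set x : (discreteRn R n * measurableTypeR R) * measurableTypeR R |
  [/\ LC x.1, 0 < x.2 & (x.2%:E < hC x.1 `^ p)%E]].
Proof.
apply: (@measurable_superlevel _ (discreteRn R n * measurableTypeR R)%type R LC (fun z => (hC z `^ p)%E)) => r r0.
by rewrite P_poweR//; apply: measurable_up_closed; apply: P_up; exact: powR_ge0.
Qed.

Let integral_h : (\int[nu R n]_(z in L) (h z `^ q)%:E =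
  \int[mu]_(r in `]0%R, +oo[) ((al * r `^ (al - 1))%R%:E * phi r))%E.
Proof.
transitivity (\int[nu_measure (n := n)]_(z in L) ((h z `^ p) `^ al)%:E)%E.
  by apply: eq_integral => z _; rewrite -powRrM pal.
apply: (@integral_powR_superlevel _ _ R (nu_measure (n := n)) L (fun z => h z `^ p) al).
- exact: al1.
- by apply: measurable_up_closed; exact: Lset_up.
- by move=> z _; exact: powR_ge0.
- exact: measurable_H.
Qed.

Let integral_hC : (\int[nu R n]_(z in LC) (hC z `^ p) =
  \int[mu]_(r in `]0%R, +oo[) psi r)%E.
Proof.
apply: (@integral_superlevel1 _ _ R (nu_measure (n := n)) LC (fun z => (hC z `^ p)%E)).
- by move=> z _; exact: poweR_ge0.
- exact: measurable_P.
Qed.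

Let integral_e b : 1 <= b ->
  (\int[mu]_(r in `]0%R, +oo[) ((b * r `^ (b - 1))%R%:E * e r) =
   (a0 * c `^ (- (p * b)))%:E * Gamma (1 + p * b))%E.
Proof.
move=> b1; rewrite EFinM -muleA -integral_powR_expR//.
rewrite -ge0_integralZl_EFin//.
- by apply: eq_integral => r _; rewrite /e EFinM muleCA.
- by move=> r _; rewrite mule_ge0// lee_fin ?expR_ge0// mulr_ge0 ?powR_ge0// (le_trans _ b1).
- apply: measurable_funTS; apply: emeasurable_funM; apply/measurable_EFinP.
    by apply: measurable_funM => //; exact: measurable_powR.
  apply: measurableT_comp => //; apply: measurableT_comp => //.
  by apply: measurable_funM => //; exact: measurable_powR.
- exact: ltW.
Qed.

Let phi_psi r : 0 < r -> (phi r <= psi r)%E.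
Proof.
move=> r0; rewrite (phiE r0) (psiE r0).
apply: nu_up_le; [exact: H_up|apply: P_up; exact: powR_ge0|exact: superlevel_sub].
Qed.

(** With l the ratio of the levels [root r] and [root s], the geometric mean of a0 and e(s) is
    exactly e(r). *)
Let e_psi r s : 0 < r -> r < s -> (e s < phi s)%E -> (e r <= psi r)%E.
Proof.
move=> r0 rs es; have s0 := lt_trans r0 rs.
have rr0 : 0 < root r by exact: powR_gt0.
have rs0 : 0 < root s by exact: powR_gt0.
have rrs : root r < root s by rewrite gt0_ltr_powR ?nnegrE ?invr_gt0 ?(ltW r0) ?(ltW s0).
pose l := root r / root s.
have l01 : 0 < l < 1 by rewrite divr_gt0//= ltr_pdivrMr// mul1r.
have lE : l * root s = root r by rewrite divfK// gt_eqF.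
have := @nu_superlevel_geometric_mean R n f h f_log_concave f_max h_ge0 h_concave l (root s)
  l01 (ltW rs0).
rewrite nuL ltry lE => /(_ isT) gm.
have b0 : 0 < a0 * expR (- (c * root s)) by rewrite mulr_gt0 ?expR_gt0.
rewrite (phiE s0) in es.
have := geometric_mean_le_fin l01 a0_gt0 b0 es gm.
rewrite (psiE r0); apply: le_trans.
rewrite /e lee_fin powRM ?expR_ge0 ?(ltW a0_gt0)// mulrA -powRD; last first.
  by rewrite subrK oner_eq0.
rewrite subrK powRr1 ?(ltW a0_gt0)// -expRM ler_pM2l// ler_expR.
by rewrite mulNr lerN2 -/(root r) -lE -mulrA (mulrC _ l) lexx.
Qed.

(* Both integrals are compared with those of the exponential profile
   [a0 * exp(- c s)] of the measure of the superlevel sets [h > s]; the variable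
   of integration is [r = s^p]. *)
Lemma berwald_comparison :
  (\int[nu R n]_(z in LC) (hC z `^ p) < (a0 * c `^ (- p))%:E * Gamma (1 + p))%E ->
  (\int[nu R n]_(z in L) (h z `^ q)%:E <= (a0 * c `^ (- q))%:E * Gamma (1 + q))%E.
Proof.
rewrite integral_hC integral_h => Y.
have eE : (\int[mu]_(r in `]0%R, +oo[) e r = (a0 * c `^ (- p))%:E * Gamma (1 + p))%E.
  rewrite -{1 2}(mulr1 p) -integral_e//; apply: eq_integral => r _.
  by rewrite subrr powRr0 mulr1 mul1e.
rewrite -eE in Y.
rewrite -pal -integral_e//.
pose S := [set s : R | 0 < s /\ (e s < phi s)%E].
have e_ge0 r : (0 <= e r)%E by rewrite lee_fin mulr_ge0 ?expR_ge0// ltW.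
have mroot (D : set R) : measurable_fun D (fun r : R => r `^ p^-1).
  by apply: measurable_funTS; exact: measurable_powR.
have me (D : set R) : measurable_fun D e.
  apply/measurable_EFinP; apply: measurable_funM => //.
  apply: measurableT_comp => //; apply: measurableT_comp => //.
  exact: measurable_funM.
have mphi : measurable_fun (`]0, +oo[%classic : set R) phi.
  apply: (eq_measurable_fun (fun r : R => nu_measure (n := n) (ysection
    [set x : (discreteRn R n * measurableTypeR R) * measurableTypeR R |
  [/\ L x.1, 0 < x.2 & (x.2%:E < (h x.1 `^ p)%:E)%E]] r))).
    move=> r; rewrite inE/= in_itv/= andbT => r0; congr nu_measure.
    by apply/seteqP; split => z; rewrite /ysection/= inE/= => -[] //.
  by apply: measurable_funTS; exact: measurable_fun_ysection.
have mpsi : measurable_fun (`]0, +oo[%classic : set R) psi.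
  apply: (eq_measurable_fun (fun r : R => nu_measure (n := n) (ysection
    [set x : (discreteRn R n * measurableTypeR R) * measurableTypeR R |
  [/\ LC x.1, 0 < x.2 & (x.2%:E < hC x.1 `^ p)%E]] r))).
    move=> r; rewrite inE/= in_itv/= andbT => r0; congr nu_measure.
    by apply/seteqP; split => z; rewrite /ysection/= inE/= => -[] //.
  by apply: measurable_funTS; exact: measurable_fun_ysection.
(* Otherwise e <= psi on the whole half-line, against the strict inequality between their
   integrals. *)
have S_bounded : has_ubound S.
  apply: contrapT => noub; move: Y; apply/negP; rewrite -leNgt.
  apply: ge0_le_integral => //; first exact: me.
  move=> r; rewrite /= in_itv/= andbT => r0.
  have [s [s0 es] rs] : exists2 s, S s & r < s.
    apply: contrapT => /forall2NP Snr; apply: noub; exists r => s Ss.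
    by have [//|/negP] := Snr s; rewrite -leNgt.
  exact: e_psi rs es.
(* If S is empty, [sup S] is 0 by default: no r lies below the crossing point, and phi <= e at every
   r > 0. *)
have S_sup r : 0 < r < sup S -> exists2 s, S s & r < s.
  move=> /andP[r0 rS]; apply: sup_gt => //.
  apply: contrapT => S0; move: rS; rewrite sup_out ?ltNge ?(ltW r0)//.
  by move=> [].
have supS0 : 0 <= sup S.
  have [[s Ss]|S0] := pselect (S !=set0); last by rewrite sup_out// => -[].
  by apply: (@le_trans _ _ s); [case: Ss => /ltW|apply: ub_le_sup].
apply: (@crossing_integral _ _ (sup S) _ psi) => //.
- move=> r /[dup] /andP[r0 _] /S_sup[s [s0 es] rs]; exact: e_psi rs es.
- move=> r Sr; rewrite leNgt; apply/negP => er.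
  have r0 := le_lt_trans supS0 Sr.
  by have := ub_le_sup S_bounded (conj r0 er); rewrite leNgt Sr.
- exact: ltW.
- rewrite eE; apply: lte_mul_pinfty => //; last exact: Gamma_lty.
  by rewrite lee_fin mulr_ge0 ?powR_ge0// ltW.
Qed.

End berwald_comparison.

Theorem theorem3p1 (R : realType) (n : nat) (f : 'rV[R]_n -> R)
    (hf : integrable_log_concave f) (hf0 : supnorm f = (f 0)%:E)
    (h : 'rV[R]_n * R -> R) (h_ge0 : forall z, Lset f z -> 0 <= h z)
    (h_concave : concave_on (Lset f) h)
    (p q : R) (hp : 0 < p) (hpq : p <= q) :
  (((Gamma (1 + q) * nu R n (Lset f))^-1 *
      \int[nu R n]_(z in Lset f) (h z `^ q)%:E) `^ q^-1
   <=
   ((Gamma (1 + p) * nu R n (Lset f))^-1 *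
      \int[nu R n]_(z in minkowski_sum (Lset f) (@cubeC R n))
        (asplund (patch (cst 0%R) (Lset f) h) \1_(@cubeC R n) z `^ p)) `^ p^-1)%E.
Proof.
have [f_log_concave _ _] := hf.
have q0 : 0 < q by exact: lt_le_trans hpq.
have p0' : p^-1 != 0 by rewrite invr_eq0 gt_eqF.
have q0' : q^-1 != 0 by rewrite invr_eq0 gt_eqF.
have Gp := Gamma_gt0 hp; have Gq := Gamma_gt0 q0.
have Gpoo := Gamma_lty hp; have Gqoo := Gamma_lty q0.
have L1 := nu_Lset_ge1 f_log_concave hf0.
have [Loo|Loo] := eqVneq (nu R n (Lset f)) +oo%E.
  (* as [+oo^-1 = 0], the left-hand side vanishes *)
  by rewrite Loo gt0_muley// invey mul0e poweR0r// poweR_ge0.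
set X := (\int[nu R n]_(z in Lset f) _)%E; set Y := (\int[nu R n]_(z in _) _)%E.
have X0 : (0 <= X)%E by apply: integral_ge0 => z _; rewrite lee_fin powR_ge0.
have Y0 : (0 <= Y)%E by apply: integral_ge0 => z _; exact: poweR_ge0.
pose a := fine (nu R n (Lset f)).
have aE : nu R n (Lset f) = a%:E.
  by rewrite fineK// ge0_fin_numE ?ltey// (le_trans _ L1).
have a0 : 0 < a by rewrite -lte_fin -aE (lt_le_trans _ L1).
have comparison c : 0 < c -> (Y < (a * c `^ (- p))%:E * Gamma (1 + p))%E ->
    (X <= (a * c `^ (- q))%:E * Gamma (1 + q))%E.
  move=> c0; exact: (berwald_comparison f_log_concave hf0 h_ge0 h_concave aE hp hpq c0).
rewrite aE; move: comparison Gp Gq Gpoo Gqoo.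
case: (Gamma (1 + p)) => [gp||]//; case: (Gamma (1 + q)) => [gq||]//.
move=> comparison; rewrite !lte_fin => gp0 gq0 _ _.
have gpa : 0 < gp * a by rewrite mulr_gt0.
have gqa : 0 < gq * a by rewrite mulr_gt0.
rewrite -!EFinM !inver !gt_eqF//.
move: Y0 comparison; case: Y => [y||//]; last first.
  by move=> _ _; rewrite gt0_muley ?lte_fin ?invr_gt0// poweRyr// leey.
rewrite lee_fin => y0 comparison.
rewrite -EFinM poweR_EFin; set b := _ * y.
have b0 : 0 <= b by rewrite mulr_ge0 ?invr_ge0 ?(ltW gpa).
(* [rho] is any number above the right-hand side, compared with [c = 1 / rho] *)
apply/lee_addgt0Pr => d d0; rewrite -EFinD; set rho := _ + d.
have brho : b `^ p^-1 < rho by rewrite ltrDl.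
have rho0 : 0 < rho by apply: le_lt_trans brho; exact: powR_ge0.
have rhoV s : rho^-1 `^ (- s) = rho `^ s.
  by rewrite -(powR_inv1 (ltW rho0)) -powRrM mulrNN mul1r.
have := comparison rho^-1; rewrite invr_gt0 rho0 !rhoV => /(_ isT).
rewrite -!EFinM lte_fin.
have -> : y < a * rho `^ p * gp.
  rewrite mulrAC (mulrC a) -ltr_pdivrMl// -/b.
  rewrite -[ltLHS](powRr1 b0) -(mulVf (lt0r_neq0 hp)) powRrM.
  by rewrite gt0_ltr_powR ?nnegrE ?powR_ge0// ltW.
move=> /(_ isT) {comparison}; move: X0; case: X => [x||//]; last by rewrite leye_eq.
rewrite !lee_fin => x0; rewrite mulrAC (mulrC a) -ler_pdivrMl// => xrho.
have x0' : 0 <= (gq * a)^-1 * x by rewrite mulr_ge0 ?invr_ge0 ?(ltW gqa).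
rewrite -[leRHS](powRr1 (ltW rho0)) -(divff (lt0r_neq0 q0)) powRrM.
by rewrite ge0_ler_powR ?nnegrE ?invr_ge0 ?(ltW q0) ?powR_ge0.
Qed.
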